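(* Let $\Omega\subset\mathbb{R}^2$ be a bounded, $C^\infty$-smooth, strictly convex domain with torsion function $u$, let $M=\max_\Omega u$, and let $x_0$ be the (unique) maximum point of $u$ in $\Omega$. Let $\phi$ be an Airy potential for $\Omega$, let $X=-\nabla\phi$, let $K$ be the convex body whose boundary is the curve $X(\partial\Omega)$, and put $X_0=X(x_0)$. Then $$K-X_0\supset\frac{2M}{3}\,(\Omega-x_0).$$
   Context: The torsion function $u\in H_0^1(\Omega)$ solves $-\Delta u=1$ in $\Omega$, $u=0$ on $\partial\Omega$; for smooth $\Omega$, $u\in C^\infty(\overline\Omega)$. Strictly convex means that $\partial\Omega$ contains no nondegenerate line segment. Let $J$ be counterclockwise rotation by $\pi/2$ and define the symmetric matrix field $$\Sigma=(|\nabla u|^2-2u)\,\mathrm{Id}-2\,\nabla u\otimes\nabla u ,$$ which is divergence-free. An Airy potential is a function $\phi\in C^\infty(\overline\Omega)$ with $\Sigma=J^TD^2\phi\,J$ in $\Omega$; it exists and is unique up to adding affine functions. It is a known fact in this setting that $X|_{\partial\Omega}$, with $X=-\nabla\phi$, parametrizes the boundary of a smooth strictly convex body $K$. *)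

(* Defs.v *)
From HB Require Import structures.
From mathcomp Require Import all_boot all_order all_algebra.
From mathcomp Require Import all_classical all_reals all_analysis.

Set Implicit Arguments.
Unset Strict Implicit.
Unset Printing Implicit Defensive.

Import Order.TTheory GRing.Theory Num.Theory.
Import numFieldNormedType.Exports.

Local Open Scope classical_set_scope.
Local Open Scope ring_scope.

(* Points of the plane are row vectors.  The library norm on 'rV[R]_2 is the
   sup norm, hence the explicit scalar product; the topology and the bounded
   sets are the Euclidean ones. *)
Definition dot (R : realType) (v w : 'rV[R]_2) : R :=
  \sum_(i < 2) v ord0 i * w ord0 i.

Definition frontier (R : realType) (A : set 'rV[R]_2) : set 'rV[R]_2 :=
  closure A `\` interior A.

Definition segment (R : realType) (a b : 'rV[R]_2) : set 'rV[R]_2 :=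
  [set (1 - t) *: a + t *: b | t in `[0, 1]].

(* pderiv [:: i1; ...; ik] f is the iterated partial derivative
   d_i1 ( ... (d_ik f)). *)
Fixpoint pderiv (R : realType) (s : seq 'I_2) (f : 'rV[R]_2 -> R) :
    'rV[R]_2 -> R :=
  if s is i :: s' then fun x => 'D_(delta_mx ord0 i) (pderiv s' f) x else f.

Definition grad (R : realType) (f : 'rV[R]_2 -> R) (x : 'rV[R]_2) : 'rV[R]_2 :=
  \row_i pderiv [:: i] f x.

Definition hessian (R : realType) (f : 'rV[R]_2 -> R) (x : 'rV[R]_2) :
    'M[R]_2 :=
  \matrix_(i, j) pderiv [:: i; j] f x.

Definition laplacian (R : realType) (f : 'rV[R]_2 -> R) (x : 'rV[R]_2) : R :=
  \sum_(i < 2) pderiv [:: i; i] f x.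

Definition smooth1 (R : realType) (g : R -> R) : Prop :=
  forall n t, derivable (derive1n n g) t 1.

(* C^oo on an open set A *)
Definition smooth_on (R : realType) (A : set 'rV[R]_2) (f : 'rV[R]_2 -> R) :
    Prop :=
  forall s x, A x ->
    {for x, continuous (pderiv s f)} /\
    forall i, derivable (pderiv s f) x (delta_mx ord0 i).

(* C^oo on the closure of an open set A: f is C^oo in A and f and all its
   partial derivatives extend continuously from A to the closure of A.
   The second conjunct says that the values of f itself on the frontier are the
   ones given by this extension; pderiv is only used at points of A. *)
Definition smooth_closure (R : realType) (A : set 'rV[R]_2)
    (f : 'rV[R]_2 -> R) : Prop :=
  [/\ smooth_on A f,
      {within closure A, continuous f} &
      forall s, exists g : 'rV[R]_2 -> R,
        {within closure A, continuous g} /\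
        forall x, A x -> g x = pderiv s f x].

(* Near each frontier point, and in suitable orthonormal coordinates, A is the
   strict epigraph of a C^oo function of one variable. *)
Definition smooth_boundary (R : realType) (A : set 'rV[R]_2) : Prop :=
  forall p, frontier A p ->
    exists e1 e2 : 'rV[R]_2, exists g : R -> R,
      [/\ [/\ dot e1 e1 = 1, dot e2 e2 = 1 & dot e1 e2 = 0],
          smooth1 g &
          \forall x \near p, A x <-> g (dot x e1) < dot x e2].

Definition domain (R : realType) (A : set 'rV[R]_2) : Prop :=
  [/\ open A, A !=set0 & connected A].

Definition strictly_convex (R : realType) (A : set 'rV[R]_2) : Prop :=
  convex_set (A : set (convex_lmodType 'rV[R]_2)) /\
  forall a b, a <> b -> ~ segment a b `<=` frontier A.

Definition convex_body (R : realType) (K : set 'rV[R]_2) : Prop :=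
  [/\ compact K, convex_set (K : set (convex_lmodType 'rV[R]_2)) &
      interior K !=set0].

(* For smooth bounded A the weak solution in H^1_0(A) is smooth up to the
   frontier, so that it is the classical solution. *)
Definition torsion_function (R : realType) (A : set 'rV[R]_2)
    (u : 'rV[R]_2 -> R) : Prop :=
  [/\ smooth_closure A u,
      forall x, A x -> - laplacian u x = 1 &
      forall x, frontier A x -> u x = 0].

(* Matrix, acting on column vectors, of the counterclockwise rotation by
   pi / 2. *)
Definition rotJ (R : realType) : 'M[R]_2 :=
  \matrix_(i, j) (if i == j then 0 else if i == ord0 then -1 else 1).

Definition Sigma (R : realType) (u : 'rV[R]_2 -> R) (x : 'rV[R]_2) : 'M[R]_2 :=
  (dot (grad u x) (grad u x) - 2 * u x)%:M
  - 2 *: ((grad u x)^T *m grad u x).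

Definition airy_potential (R : realType) (A : set 'rV[R]_2)
    (u phi : 'rV[R]_2 -> R) : Prop :=
  smooth_closure A phi /\
  forall x, A x -> Sigma u x = (rotJ R)^T *m hessian phi x *m rotJ R.

(* X = - grad phi on the closure of A: on the frontier, grad phi is the
   continuous extension of the gradient computed in A. *)
Definition is_opp_grad (R : realType) (A : set 'rV[R]_2)
    (phi : 'rV[R]_2 -> R) (X : 'rV[R]_2 -> 'rV[R]_2) : Prop :=
  {within closure A, continuous X} /\
  forall x, A x -> X x = - grad phi x.

(* Main.v *)
Require Import Defs.
From HB Require Import structures.
From mathcomp Require Import all_boot all_order all_algebra.
From mathcomp Require Import all_classical all_reals all_analysis.
From mathcomp Require Import ring lra.

(** Fix a unit vector nu and let l(x) = (x - x0).nu, with supremum H on Omega.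

    Makar-Limanov's function Q = 2 u det D^2 u - cof(D^2 u) grad u . grad u
    satisfies Lap Q = - 8 u |grad u_11|^2 <= 0, and Q >= 0 on the frontier by
    convexity; the strong minimum principle gives Q > 0, that is, strict
    concavity of sqrt u.  Hence on each chord {l = t} the function u has a
    unique critical point Gamma(t), which depends smoothly on t.  Put
    m = u(Gamma), v = - m' and f = (X(Gamma) - X0).nu.  Then
    f' = 2 m - v^2, m'' >= - 1 (so v^2 <= 2 (M - m)) and sqrt m is concave
    (so 2 m v' + v^2 >= 0).  Consequently
    f - (2 M / 3) t - (2 / 3) m (2 M - 2 m + v^2) / v has the derivative
    (1 / 3) (2 M - 2 m - v^2) (1 + 2 m v' / v^2) >= 0 and tends to 0 as t -> 0,
    so f >= (2 M / 3) t.  Letting t -> H gives a frontier point p with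
    (X(p) - X0).nu >= (2 M / 3) H.  As X(p) is in K, the support function of
    K - X0 dominates that of (2 M / 3) (Omega - x0). *)

Import Order.TTheory GRing.Theory Num.Theory.
Import numFieldNormedType.Exports.

Local Open Scope classical_set_scope.
Local Open Scope ring_scope.

Set Implicit Arguments.
Unset Strict Implicit.
Unset Printing Implicit Defensive.

(** * Coordinates, differentiability and mixed derivatives in the plane *)

Section Plane.
Variable R : realType.
Implicit Types (v w x y : 'rV[R]_2).

(** In an orthonormal frame (nu, tau) the curve Gamma is the zero set of u_tau, so m' = u_nu and m''
    = u_nunu - u_nutau^2 / u_tautau. Since D^2 u has trace - 1 and u_tautau < 0 on Gamma, m'' >= -
    1. There too 2 m m'' - m'^2 = Q / u_tautau, so the sign of Q is exactly what the concavity of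
    sqrt m requires. The Airy relation gives X . nu the gradient (|grad u|^2 + 2 u) nu - 2 u_nu grad
    u; on Gamma, where grad u is parallel to nu, this is (2 m - v^2) nu, whence f'.

    The constant is that of a strip: for m = M - t^2 / 2 one gets f = 2 M t - 2 t^3 / 3, which
    equals (2 M / 3) t at the zero t = sqrt (2 M) of m.

    Derivatives are computed inside Omega only. The sign of Q on the frontier is therefore read off
    continuous extensions of the derivatives, and p is extracted by compactness, without following
    Gamma to its end. *)

Definition px v : R := v ord0 0.
Definition py v : R := v ord0 1.

Definition mkv (a b : R) : 'rV[R]_2 := \row_i (if i == 0 then a else b).

Lemma px_mkv a b : px (mkv a b) = a. Proof. by rewrite /px mxE. Qed.
Lemma py_mkv a b : py (mkv a b) = b. Proof. by rewrite /py mxE. Qed.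
Lemma pxD v w : px (v + w) = px v + px w. Proof. by rewrite /px mxE. Qed.
Lemma pyD v w : py (v + w) = py v + py w. Proof. by rewrite /py mxE. Qed.
Lemma pxN v : px (- v) = - px v. Proof. by rewrite /px mxE. Qed.
Lemma pyN v : py (- v) = - py v. Proof. by rewrite /py mxE. Qed.
Lemma pxZ k v : px (k *: v) = k * px v. Proof. by rewrite /px mxE. Qed.
Lemma pyZ k v : py (k *: v) = k * py v. Proof. by rewrite /py mxE. Qed.
Lemma px0 : px 0 = 0. Proof. by rewrite /px mxE. Qed.
Lemma py0 : py 0 = 0. Proof. by rewrite /py mxE. Qed.

Definition pE := (px_mkv, py_mkv, pxD, pyD, pxN, pyN, pxZ, pyZ, px0, py0).

Lemma ord2P (i : 'I_2) : i = 0 \/ i = 1.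
Proof.
by case: i => [[|[|//]] h]; [left|right]; apply: val_inj.
Qed.

Lemma eq_pxy v w : px v = px w -> py v = py w -> v = w.
Proof.
move=> ex ey; apply/rowP => i.
by have [->|->] := ord2P i; [exact: ex | exact: ey].
Qed.

Lemma mkvE v : mkv (px v) (py v) = v.
Proof. by apply: eq_pxy; rewrite pE. Qed.

Lemma dotE v w : dot v w = px v * px w + py v * py w.
Proof.
by rewrite /dot big_ord_recl big_ord1; congr (_ + v _ _ * w _ _); apply: val_inj.
Qed.

Lemma norm_pxy v : `|v| = Num.max `|px v| `|py v|.
Proof.
rewrite [LHS]/Num.Def.normr /= mx_normrE; apply/eqP; rewrite eq_le.
apply/andP; split.
  apply: bigmax_le => [|[i j] _ /=]; first by rewrite le_max normr_ge0.
  rewrite (ord1 i) le_max; have [->|->] := ord2P j.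
    by apply/orP; left; exact: lexx.
  by apply/orP; right; exact: lexx.
rewrite ge_max; apply/andP; split.
  exact: (le_bigmax _ (fun ij => `|v ij.1 ij.2|) (ord0, 0)).
exact: (le_bigmax _ (fun ij => `|v ij.1 ij.2|) (ord0, 1)).
Qed.

Lemma px_le_norm v : `|px v| <= `|v|.
Proof. by rewrite norm_pxy le_max lexx. Qed.
Lemma py_le_norm v : `|py v| <= `|v|.
Proof. by rewrite norm_pxy le_max lexx orbT. Qed.

Lemma norm_lt v r : (`|v| < r) = (`|px v| < r) && (`|py v| < r).
Proof. by rewrite norm_pxy gt_max. Qed.

Lemma px_continuous : continuous px.
Proof. by move=> x; apply: coord_continuous. Qed.

Lemma py_continuous : continuous py.
Proof. by move=> x; apply: coord_continuous. Qed.

Lemma delta0E : delta_mx ord0 0 = mkv 1 0 :> 'rV[R]_2.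
Proof. by apply: eq_pxy; rewrite /px /py !mxE. Qed.
Lemma delta1E : delta_mx ord0 1 = mkv 0 1 :> 'rV[R]_2.
Proof. by apply: eq_pxy; rewrite /px /py !mxE. Qed.

Lemma openP (A : set 'rV[R]_2) x : open A -> A x ->
  exists2 r, 0 < r & forall y, `|y - x| < r -> A y.
Proof.
move=> oA Ax; have := open_nbhs_nbhs (conj oA Ax) => /nbhs_normP[r /= r0 rA].
by exists r => // y yr; apply: rA; rewrite /ball_ /= distrC.
Qed.

Lemma continuousP (f : 'rV[R]_2 -> R) x : {for x, continuous f} ->
  forall e, 0 < e -> exists2 r, 0 < r & forall y, `|y - x| < r -> `|f y - f x| < e.
Proof.
move=> /cvgrPdist_lt cf e /cf /nbhs_normP[r /= r0 rA].
by exists r => // y yr; rewrite distrC; apply: rA; rewrite /ball_ /= distrC.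
Qed.

Lemma is_derive_line (f : 'rV[R]_2 -> R) y v (t : R) :
  derivable f (y + t *: v) v ->
  is_derive t 1 (fun s => f (y + s *: v)) ('D_v f (y + t *: v)).
Proof.
have E : (fun h : R => h^-1 *: (f (h *: v + (y + t *: v)) - f (y + t *: v))) =
    (fun h : R => h^-1 *: ((fun s => f (y + s *: v)) (h *: 1 + t)
        - (fun s => f (y + s *: v)) t)).
  apply/funext => h; congr (_ *: (f _ - _)).
  by rewrite [h *: 1]mulr1 scalerDl addrCA.
by move=> df; apply: DeriveDef; rewrite /derivable /derive /= -E.
Qed.

Lemma MVT01 (f f' : R -> R) :
  (forall t : R, 0 <= t <= 1 -> is_derive t 1 f (f' t)) ->
  exists2 c, 0 < c < 1 & f 1 - f 0 = f' c.
Proof.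
move=> df; have [|||c] := @MVT R f f' 0 1; first exact: ltr01.
- by move=> x; rewrite in_itv /= => /andP[/ltW x0 /ltW x1]; apply: df; rewrite x0.
- apply: derivable_within_continuous => x; rewrite in_itv /= => x01.
  by have [] := df x x01.
by rewrite in_itv /= subr0 mulr1 => cI E; exists c.
Qed.

Lemma MVT_line (f : 'rV[R]_2 -> R) y v (h : R) :
  (forall t : R, 0 <= t <= 1 -> derivable f (y + (t * h) *: v) v) ->
  exists2 t, 0 < t < 1 & f (y + h *: v) - f y = h * 'D_v f (y + (t * h) *: v).
Proof.
move=> df.
have [t tI|c cI] := @MVT01 (fun t => f (y + (t * h) *: v))
  (fun t => h * 'D_v f (y + (t * h) *: v)).
  have d1 := is_derive_line (df t tI).
  have d2 : is_derive t 1 (fun s : R => s * h) h.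
    by apply: is_derive_eq; rewrite scaler0 add0r [_ *: _]mulr1.
  have := @is_derive1_comp R (fun s => f (y + s *: v)) (fun s => s * h) t _ _ d1 d2.
  by rewrite mulrC.
by rewrite mul1r mul0r scale0r addr0 => E; exists c.
Qed.

(** Total differentiability, with the components of the gradient given as arbitrary functions rather
    than as [pderiv]: identities valid on [A] only, such as u_22 = - 1 - u_11, can be built into the
    data. *)
Definition has_grad (A : set 'rV[R]_2) (f g0 g1 : 'rV[R]_2 -> R) :=
  forall x, A x ->
    differentiable f x /\ forall v, 'd f x v = g0 x * px v + g1 x * py v.

Lemma chain_rule A f g0 g1 (gam : R -> 'rV[R]_2) (t : R) (w : 'rV[R]_2) :
  has_grad A f g0 g1 -> is_derive t 1 gam w -> A (gam t) ->
  is_derive t 1 (fun s => f (gam s)) (g0 (gam t) * px w + g1 (gam t) * py w).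
Proof.
move=> hf [dgam Dgam] At; have [df dE] := hf _ At.
have dg : differentiable gam t by apply/derivable1_diffP.
have dc : differentiable (f \o gam) t by apply: differentiable_comp.
apply: DeriveDef; first exact/derivable1_diffP.
rewrite -[LHS]/('D_1 (f \o gam) t) deriveE// diff_comp//= dE.
by rewrite -deriveE// Dgam.
Qed.

Lemma has_grad_cont A f g0 g1 x :
  has_grad A f g0 g1 -> A x -> {for x, continuous f}.
Proof. by move=> h /h[d _]; apply: differentiable_continuous. Qed.

(** The increment is split into a vertical step followed by a horizontal one. The mean value theorem
    turns each into a partial derivative at an intermediate point, which continuity compares with
    its value at [x]. *)
Lemma C1_differentiable (f : 'rV[R]_2 -> R) (A : set 'rV[R]_2) x :
  open A -> A x ->
  (forall y, A y -> derivable f y (delta_mx ord0 0)) ->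
  (forall y, A y -> derivable f y (delta_mx ord0 1)) ->
  {for x, continuous (fun y => 'D_(delta_mx ord0 0) f y)} ->
  {for x, continuous (fun y => 'D_(delta_mx ord0 1) f y)} ->
  differentiable f x.
Proof.
move=> oA Ax d0 d1 c0 c1.
pose D0 := fun y => 'D_(delta_mx ord0 0) f y.
pose D1 := fun y => 'D_(delta_mx ord0 1) f y.
have [rA rA0 rAP] := openP oA Ax.
pose L : 'rV[R]_2 -> R := fun v => D0 x * px v + D1 x * py v.
have Llin : linear L.
  by move=> k v w; rewrite /L !pE -[k *: _]/(k * _); ring.
pose Lm := GRing.isLinear.Build R 'rV[R]_2 R *:%R L Llin.
pose LL : {linear 'rV[R]_2 -> R} := HB.pack L Lm.
have cL : continuous LL.
  rewrite -[X in continuous X]/L => y; rewrite /L.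
  have h0 : (fun v => D0 x * px v) v @[v --> y] --> D0 x * px y.
    exact: (cvgM (cvg_cst (D0 x)) (@px_continuous y)).
  have h1 : (fun v => D1 x * py v) v @[v --> y] --> D1 x * py y.
    exact: (cvgM (cvg_cst (D1 x)) (@py_continuous y)).
  exact: (cvgD h0 h1).
suff o : (fun h => f (h + x) - (f x + L h)) =o_ (0 : 'rV[R]_2) id.
  have H : f \o shift x = cst (f x) + L +o_ (0 : 'rV[R]_2) id.
    apply/eqaddoP => e e0; move/eqoP : o => /(_ e e0); apply: filterS => h.
    by [].
  have E := @diff_unique R 'rV[R]_2 R f LL x cL H.
  by apply/diff_locallyP; rewrite E.
apply/eqoP => e e0.
have e2 : 0 < e / 2 by rewrite divr_gt0.
have [r0 r00 r0P] := continuousP c0 e2.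
have [r1 r10 r1P] := continuousP c1 e2.
pose r := Num.min rA (Num.min r0 r1).
have r_gt0 : 0 < r by rewrite !lt_min rA0 r00 r10.
suff : \forall h \near (0 : 'rV[R]_2), `|f (h + x) - (f x + L h)| <= e * `|h|.
  by [].
near=> h.
have hr : `|h| < r by near: h; exact (@nbhs0_lt R 'rV[R]_2 r r_gt0).
have bnd a b : `|a| <= `|px h| -> `|b| <= `|py h| -> `|mkv a b| < r.
  move=> ha hb; apply: le_lt_trans hr; rewrite !norm_pxy !pE.
  by rewrite ge_max !le_max ha hb orbT.
have inA a b : `|a| <= `|px h| -> `|b| <= `|py h| ->
   [/\ A (x + mkv a b), `|D0 (x + mkv a b) - D0 x| < e / 2
     & `|D1 (x + mkv a b) - D1 x| < e / 2].
  move=> ha hb; have := bnd _ _ ha hb; rewrite /r !lt_min => /and3P[hA h0 h1].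
  by split; [apply: rAP|apply: r0P|apply: r1P]; rewrite addrC addKr.
have tle t (k : R) : 0 <= t <= 1 -> `|t * k| <= `|k|.
  by move=> /andP[t0 t1]; rewrite normrM ger0_norm// ler_piMl.
have [t t01|t /andP[/ltW t0 /ltW t1] Et] := @MVT_line f (x + mkv 0 (py h)) (delta_mx ord0 0) (px h).
  apply: d0; rewrite delta0E (_ : _ + _ = x + mkv (t * px h) (py h)).
    by have [] := inA (t * px h) (py h) (tle _ _ t01) (lexx _).
  by apply: eq_pxy; rewrite !pE; ring.
have [s s01|s /andP[/ltW s0 /ltW s1] Es] := @MVT_line f x (delta_mx ord0 1) (py h).
  apply: d1; rewrite delta1E (_ : _ + _ = x + mkv 0 (s * py h)).
    by have [] := inA 0 (s * py h) _ (tle _ _ s01); rewrite ?normr0.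
  by apply: eq_pxy; rewrite !pE; ring.
have e1 : x + mkv 0 (py h) + px h *: delta_mx ord0 0 = h + x.
  by rewrite delta0E; apply: eq_pxy; rewrite !pE; ring.
have e3 : x + py h *: delta_mx ord0 1 = x + mkv 0 (py h).
  by rewrite delta1E; apply: eq_pxy; rewrite !pE; ring.
have e4 : x + mkv 0 (py h) + (t * px h) *: delta_mx ord0 0
    = x + mkv (t * px h) (py h).
  by rewrite delta0E; apply: eq_pxy; rewrite !pE; ring.
have e5 : x + (s * py h) *: delta_mx ord0 1 = x + mkv 0 (s * py h).
  by rewrite delta1E; apply: eq_pxy; rewrite !pE; ring.
rewrite e1 e4 in Et; rewrite e3 e5 in Es.
have -> : f (h + x) - (f x + L h) =
   px h * (D0 (x + mkv (t * px h) (py h)) - D0 x) +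
   py h * (D1 (x + mkv 0 (s * py h)) - D1 x).
  rewrite !mulrBr -Et -Es /L; ring.
have t01 : 0 <= t <= 1 by rewrite t0.
have s01 : 0 <= s <= 1 by rewrite s0.
have [_ b0 _] := inA _ _ (tle _ (px h) t01) (lexx _).
have [|_ _ b1] := inA 0 _ _ (tle _ (py h) s01); first by rewrite normr0.
apply: le_trans (ler_normD _ _) _.
have -> : e * `|h| = e / 2 * `|h| + e / 2 * `|h| by rewrite -mulrDl -splitr.
apply: lerD; rewrite normrM mulrC; apply: ler_pM;
  [exact: normr_ge0|exact: normr_ge0|exact: ltW b0|exact: px_le_norm
  |exact: normr_ge0|exact: normr_ge0|exact: ltW b1|exact: py_le_norm].
Unshelve. all: by end_near. Qed.

Lemma C1_has_grad (f : 'rV[R]_2 -> R) (A : set 'rV[R]_2) :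
  open A ->
  (forall y i, A y -> derivable f y (delta_mx ord0 i)) ->
  (forall y i, A y -> {for y, continuous (pderiv [:: i] f)}) ->
  has_grad A f (pderiv [:: 0] f) (pderiv [:: 1] f).
Proof.
move=> oA df cf x Ax.
have d : differentiable f x.
  by apply: (C1_differentiable oA Ax) => [y Ay|y Ay||]; try exact: df;
     exact: cf.
split => // v; rewrite /= !deriveE//.
rewrite -{1}(mkvE v) (_ : mkv _ _ = px v *: delta_mx ord0 0 + py v *: delta_mx ord0 1).
  rewrite linearD !linearZ /= -![_ *: 'd _ _ _]/(_ * _) mulrC.
  by congr (_ + _); rewrite mulrC.
by rewrite delta0E delta1E; apply: eq_pxy; rewrite !pE; ring.
Qed.

Lemma line_derive A f g0 g1 y v (t : R) : has_grad A f g0 g1 ->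
  A (y + t *: v) ->
  is_derive t 1 (fun s => f (y + s *: v))
    (g0 (y + t *: v) * px v + g1 (y + t *: v) * py v).
Proof.
move=> hf At; have [df dE] := hf _ At.
by rewrite -dE -deriveE//; apply: is_derive_line; apply: diff_derivable.
Qed.

(** The second difference of [f] over a small square with corner [x] is, by the mean value theorem
    used twice in either order, h^2 times a value of [f01] and also h^2 times a value of [f10]. If
    these functions differed at [x], continuity would keep the two values apart. *)
Lemma schwarz A f f0 f1 f00 f01 f10 f11 :
  open A -> has_grad A f f0 f1 -> has_grad A f0 f00 f01 ->
  has_grad A f1 f10 f11 ->
  (forall x, A x -> {for x, continuous f01}) ->
  (forall x, A x -> {for x, continuous f10}) ->
  forall x, A x -> f01 x = f10 x.
Proof.
move=> oA hf hf0 hf1 c01 c10 x Ax.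
apply/eqP/negPn/negP => neq.
pose e := `|f01 x - f10 x| / 2.
have e0 : 0 < e by rewrite divr_gt0// normr_gt0 subr_eq0.
have [rA rA0 rAP] := openP oA Ax.
have [r0 r00 r0P] := continuousP (c01 _ Ax) e0.
have [r1 r10 r1P] := continuousP (c10 _ Ax) e0.
pose r := Num.min rA (Num.min r0 r1).
have r_gt0 : 0 < r by rewrite !lt_min rA0 r00 r10.
pose h := r / 2.
have h0 : 0 < h by rewrite divr_gt0.
have inA a b : 0 <= a <= 1 -> 0 <= b <= 1 ->
   [/\ A (x + mkv (a * h) (b * h)), `|f01 (x + mkv (a * h) (b * h)) - f01 x| < e
     & `|f10 (x + mkv (a * h) (b * h)) - f10 x| < e].
  move=> ha hb; have : `|mkv (a * h) (b * h)| < r.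
    by rewrite norm_lt !pE /h !ger0_norm; nra.
  rewrite /r !lt_min => /and3P[hA hr0 hr1].
  by split; [apply: rAP|apply: r0P|apply: r1P]; rewrite addrC addKr.
have step (g g0 g1 : 'rV[R]_2 -> R) y v (p q : R -> R) (hg : has_grad A g g0 g1) :
  (forall t : R, 0 <= t <= 1 -> y + t *: v = x + mkv (p t * h) (q t * h)) ->
  (forall t : R, 0 <= t <= 1 -> 0 <= p t <= 1) ->
  (forall t : R, 0 <= t <= 1 -> 0 <= q t <= 1) ->
  forall t : R, 0 <= t <= 1 -> is_derive t 1 (fun s => g (y + s *: v))
    (g0 (x + mkv (p t * h) (q t * h)) * px v +
     g1 (x + mkv (p t * h) (q t * h)) * py v).
  move=> E hp hq t t01; rewrite -E//; apply: (line_derive hg); rewrite E//.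
  by have [] := inA _ _ (hp _ t01) (hq _ t01).
have I0 : (0 : R) <= 0 <= (1 : R) by lra.
have I1 : (0 : R) <= 1 <= (1 : R) by lra.
pose D := f (x + mkv h h) - f (x + mkv h 0) - f (x + mkv 0 h) + f x.
have [t t01 Et] : exists2 t, 0 < t < 1 &
   D = h * (f0 (x + mkv (t * h) (1 * h)) - f0 (x + mkv (t * h) (0 * h))).
  have [t t01|t t01 E] := @MVT01
    (fun t => f (x + mkv 0 h + t *: mkv h 0) - f (x + t *: mkv h 0))
    (fun t => h * (f0 (x + mkv (t * h) (1 * h)) - f0 (x + mkv (t * h) (0 * h)))).
    have ia := step f f0 f1 (x + mkv 0 h) (mkv h 0) id (cst 1) hf.
    have ib := step f f0 f1 x (mkv h 0) id (cst 0) hf.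
    have {}ia := ia _ (fun _ => id) (fun _ _ => I1) t t01.
    have {}ib := ib _ (fun _ => id) (fun _ _ => I0) t t01.
    apply: is_derive_eq.
      apply: is_deriveB.
        by apply: ia => s _; apply: eq_pxy; rewrite !pE /=; ring.
      by apply: ib => s _; apply: eq_pxy; rewrite !pE /=; ring.
    by rewrite !pE /=; ring.
  exists t => //; rewrite -E /D !scale1r !scale0r !addr0.
  rewrite (_ : x + mkv 0 h + mkv h 0 = x + mkv h h).
    by ring.
  by apply: eq_pxy; rewrite !pE; ring.
have [s s01 Es] : exists2 t, 0 < t < 1 &
   D = h * (f1 (x + mkv (1 * h) (t * h)) - f1 (x + mkv (0 * h) (t * h))).
  have [t' t'01|t' t'01 E] := @MVT01
    (fun t => f (x + mkv h 0 + t *: mkv 0 h) - f (x + t *: mkv 0 h))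
    (fun t => h * (f1 (x + mkv (1 * h) (t * h)) - f1 (x + mkv (0 * h) (t * h)))).
    have ia := step f f0 f1 (x + mkv h 0) (mkv 0 h) (cst 1) id hf.
    have ib := step f f0 f1 x (mkv 0 h) (cst 0) id hf.
    have {}ia := ia _ (fun _ _ => I1) (fun _ => id) t' t'01.
    have {}ib := ib _ (fun _ _ => I0) (fun _ => id) t' t'01.
    apply: is_derive_eq.
      apply: is_deriveB.
        by apply: ia => z _; apply: eq_pxy; rewrite !pE /=; ring.
      by apply: ib => z _; apply: eq_pxy; rewrite !pE /=; ring.
    by rewrite !pE /=; ring.
  exists t' => //; rewrite -E /D !scale1r !scale0r !addr0.
  rewrite (_ : x + mkv h 0 + mkv 0 h = x + mkv h h).
    by ring.
  by apply: eq_pxy; rewrite !pE; ring.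
have tI : 0 <= t <= 1 by case/andP: t01 => /ltW -> /ltW ->.
have sI : 0 <= s <= 1 by case/andP: s01 => /ltW -> /ltW ->.
have [t2 t201 Et2] : exists2 z, 0 < z < 1 &
   f0 (x + mkv (t * h) (1 * h)) - f0 (x + mkv (t * h) (0 * h)) =
   h * f01 (x + mkv (t * h) (z * h)).
  have ia := step f0 f00 f01 (x + mkv (t * h) 0) (mkv 0 h) (cst t) id hf0.
  have {}ia := ia _ (fun _ _ => tI) (fun _ => id).
  have [z z01|z z01 E] := MVT01 (ia _).
    by apply: eq_pxy; rewrite !pE /=; ring.
  exists z => //; move: E; rewrite scale1r scale0r addr0 !pE /= mulr0 add0r mul0r.
  rewrite (mulrC h) => <-; congr (f0 _ - _).
  by apply: eq_pxy; rewrite !pE; ring.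
have [s2 s201 Es2] : exists2 z, 0 < z < 1 &
   f1 (x + mkv (1 * h) (s * h)) - f1 (x + mkv (0 * h) (s * h)) =
   h * f10 (x + mkv (z * h) (s * h)).
  have ia := step f1 f10 f11 (x + mkv 0 (s * h)) (mkv h 0) id (cst s) hf1.
  have {}ia := ia _ (fun _ => id) (fun _ _ => sI).
  have [z z01|z z01 E] := MVT01 (ia _).
    by apply: eq_pxy; rewrite !pE /=; ring.
  exists z => //; move: E; rewrite scale1r scale0r addr0 !pE /= mulr0 addr0 mul0r.
  rewrite (mulrC h) => <-; congr (f1 _ - _).
  by apply: eq_pxy; rewrite !pE; ring.
have eqf : f01 (x + mkv (t * h) (t2 * h)) = f10 (x + mkv (s2 * h) (s * h)).
  have hn : h * h != 0 by rewrite mulf_neq0// gt_eqF.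
  apply: (mulfI hn).
  rewrite -[LHS]/(h * h * f01 _) -[RHS]/(h * h * f10 _).
  by rewrite -[LHS]mulrA -[RHS]mulrA -Et2 -Es2 -Et -Es.
have wI (z : R) : 0 < z < 1 -> 0 <= z <= 1 by case/andP => /ltW -> /ltW ->.
have [_ b1 _] := inA _ _ tI (wI _ t201).
have [_ _ b2] := inA _ _ (wI _ s201) sI.
suff : `|f01 x - f10 x| < `|f01 x - f10 x| by rewrite ltxx.
have Ee : `|f01 x - f10 x| = e + e by rewrite /e -splitr.
rewrite [ltRHS]Ee.
rewrite eqf in b1; rewrite distrC in b1.
apply: le_lt_trans (ltrD b1 b2).
apply: le_trans (ler_normD _ _).
by rewrite addrA subrK.
Qed.

End Plane.

(** * Derivatives of functions of one variable *)

Section RealLine.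
Variable R : realType.
Implicit Types (f g : R -> R) (t l : R).

Lemma der_eq f t l l' : is_derive t 1 f l -> l = l' -> is_derive t 1 f l'.
Proof. by move=> ? <-. Qed.

Lemma derC t (k : R) : is_derive t 1 (fun _ : R => k) 0.
Proof. exact: is_derive_cst. Qed.

Lemma derI t : is_derive t 1 (fun s : R => s) 1.
Proof. exact: is_derive_id. Qed.

Lemma derD f g t df dg : is_derive t 1 f df -> is_derive t 1 g dg ->
  is_derive t 1 (fun s => f s + g s) (df + dg).
Proof. by move=> hf hg; exact: is_deriveD. Qed.

Lemma derN f t df : is_derive t 1 f df -> is_derive t 1 (fun s => - f s) (- df).
Proof. by move=> hf; exact: is_deriveN. Qed.

Lemma derM f g t df dg : is_derive t 1 f df -> is_derive t 1 g dg ->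
  is_derive t 1 (fun s => f s * g s) (f t * dg + g t * df).
Proof. by move=> hf hg; exact: is_deriveM. Qed.

Lemma derV f t df : f t != 0 -> is_derive t 1 f df ->
  is_derive t 1 (fun s => (f s)^-1) (- (f t) ^- 2 * df).
Proof. by move=> f0 hf; exact: is_deriveV. Qed.

Lemma der_eps f t l : is_derive t 1 f l -> forall e, 0 < e ->
  exists2 r : R, 0 < r &
    forall h : R, h != 0 -> `|h| < r -> `|(f (t + h) - f t) / h - l| < e.
Proof.
move=> [df Df] e e0.
have : (fun h => h^-1 *: (f (h *: 1 + t) - f t)) @ 0^' --> l by rewrite -Df.
move/cvgrPdist_lt => /(_ e e0) [r /= r0 rP]; exists r => // h h0 hr.
have := rP h _ h0; rewrite /= sub0r normrN => /(_ hr).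
by rewrite distrC [h *: 1]mulr1 (addrC h) [_^-1 *: _]mulrC.
Qed.

Lemma eps_der f t l : (forall e : R, 0 < e -> exists2 r : R, 0 < r &
    forall h : R, h != 0 -> `|h| < r -> `|(f (t + h) - f t) / h - l| < e) ->
  is_derive t 1 f l.
Proof.
move=> H.
have C : (fun h => h^-1 *: (f (h *: 1 + t) - f t)) @ 0^' --> l.
  apply/cvgrPdist_lt => e /H [r r0 rP]; exists r => //= h.
  rewrite /= sub0r normrN => hr h0; have := rP h h0 hr.
  by rewrite distrC [h *: 1]mulr1 (addrC h) [_^-1 *: _]mulrC.
by apply: DeriveDef; [apply: (cvgP l) | apply: cvg_lim].
Qed.

(** A negative [q2] would make [q1], which vanishes at the minimum, negative just to the right of 0,
    and [q] would decrease there. *)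
Lemma second_derivative_test (q q1 : R -> R) (q2 r : R) : 0 < r ->
  (forall t : R, `|t| < r -> is_derive t 1 q (q1 t)) -> is_derive (0 : R) 1 q1 q2 ->
  (forall t : R, `|t| < r -> q 0 <= q t) -> 0 <= q2.
Proof.
move=> r0 dq dq1 mn; rewrite leNgt; apply/negP => q20.
have Ir t : t \in `]-r, r[%R -> `|t| < r by rewrite in_itv /= ltr_norml.
have z1 : q1 0 = 0.
  have h0 : `|0 : R| < r by rewrite normr0.
  have [|t /Ir /dq[]//||t /Ir /mn //|_ E] := @derive1_at_min R q (- r) r 0.
  - by lra.
  - by rewrite in_itv /=; lra.
  - by have [_ <-] := dq _ h0.
have q2p : 0 < - q2 by lra.
have [s s0 sP] := der_eps dq1 q2p.
pose t := Num.min r s / 2.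
have m0 : 0 < Num.min r s by rewrite lt_min r0.
have t0 : 0 < t by rewrite /t; lra.
have [tr ts] : t < r /\ t < s.
  by apply/andP; rewrite -lt_min /t; lra.
have [x|x|x] := @MVT R q q1 0 t t0.
- by rewrite in_itv /= => xI; apply: dq; rewrite ltr_norml; lra.
- apply: derivable_within_continuous => y; rewrite in_itv /= => yI.
  have yr : `|y| < r by rewrite ltr_norml; lra.
  by have [] := dq y yr.
rewrite in_itv /= subr0 => /andP[x0 xt] E.
have xs : `|x| < s by rewrite gtr0_norm//; lra.
have := sP x (lt0r_neq0 x0) xs; rewrite add0r z1 subr0 => D.
have : q1 x / x < 0 by move: D; rewrite ltr_norml; lra.
rewrite pmulr_llt0 ?invr_gt0// => q1x.
have := mn t; rewrite gtr0_norm// => /(_ tr).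
have : q1 x * t < 0 by rewrite pmulr_llt0.
lra.
Qed.

End RealLine.

(** Derivatives recorded in the context are tried first. The resulting derivative is left to
    unification and compared with the announced one through [der_eq]. *)
Ltac der_step := first
  [ eassumption | eapply derD | eapply derN | eapply derM | eapply derI
  | eapply derC ].
Ltac der := repeat der_step.

(** * The differential inequality for Makar-Limanov's function Q *)

(* [a], [b] are [u_11], [u_12]; [c], [d] the derivatives of [a], and [e], [k]
   those of [c].  The other derivatives follow from [u_22 = - 1 - a]. *)
Section Jet.
Variables (R : realType) (A : set 'rV[R]_2).
Variables (u p0 p1 a b c d e k : 'rV[R]_2 -> R).
Hypothesis oA : open A.
Hypothesis hu : has_grad A u p0 p1.
Hypothesis hp0 : has_grad A p0 a b.
Hypothesis hp1 : has_grad A p1 b (fun x => - 1 - a x).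
Hypothesis ha : has_grad A a c d.
Hypothesis hb : has_grad A b d (fun x => - c x).
Hypothesis hc : has_grad A c e k.
Hypothesis hd : has_grad A d k (fun x => - e x).

(* Makar-Limanov's function [2 u det D^2 u - cof(D^2 u) grad u . grad u], with
   [u_22] eliminated by [u_11 + u_22 = - 1]. *)
Definition makar_limanov (x : 'rV[R]_2) : R :=
  2 * u x * (- (1 + a x) * a x - b x * b x) + (1 + a x) * (p0 x * p0 x)
  + 2 * b x * (p0 x * p1 x) - a x * (p1 x * p1 x).

Lemma nbhs_line (z v : 'rV[R]_2) r : 0 < r -> `|v| <= 1 ->
  (forall y, `|y - z| < r -> A y) ->
  forall t : R, `|t| < r -> A (z + t *: v).
Proof.
move=> r0 v1 rA t tr; apply: rA; rewrite addrC addKr normrZ.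
by apply: le_lt_trans tr; rewrite ler_piMr.
Qed.

(** At an interior minimum of Q - [beta] both pure second derivatives are nonnegative, and their sum
    is Lap Q - Lap [beta]; the formula for Lap Q is a polynomial identity in the derivatives of u.
    As [beta] is differentiated only along the two axes through [z], a constant, a quadratic and an
    inverse squared distance can all serve as comparison functions. *)
Lemma ml_local_min (z : 'rV[R]_2) (r : R) (beta : 'rV[R]_2 -> R)
  (b0 b1 : R -> R) (B0 B1 : R) : A z -> 0 < r ->
  (forall y, `|y - z| < r -> A y) ->
  (forall y, `|y - z| < r -> makar_limanov z - beta z <= makar_limanov y - beta y) ->
  (forall t : R, `|t| < r ->
     is_derive t 1 (fun s => beta (z + s *: mkv 1 0)) (b0 t)) ->
  is_derive (0 : R) 1 b0 B0 ->
  (forall t : R, `|t| < r ->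
     is_derive t 1 (fun s => beta (z + s *: mkv 0 1)) (b1 t)) ->
  is_derive (0 : R) 1 b1 B1 ->
  B0 + B1 <= - 8 * u z * (c z * c z + d z * d z).
Proof.
move=> Az r0 rA rmin db0 dB0 db1 dB1.
have n0 : `|mkv 1 0 : 'rV[R]_2| <= 1.
  by rewrite norm_pxy !pE normr1 normr0 ge_max lexx ler01.
have n1 : `|mkv 0 1 : 'rV[R]_2| <= 1.
  by rewrite norm_pxy !pE normr1 normr0 ge_max lexx ler01.
(* [Q0] and [Q1] are the partial derivatives of Q; [Q00] and [Q11] below are its pure second
   derivatives at [z], with [D00] and [D11] those of det D^2 u. *)
pose Q0 x := 2 * p0 x * (- (1 + a x) * a x - b x * b x)
  + 2 * u x * (- c x * a x - (1 + a x) * c x - 2 * b x * d x)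
  + c x * (p0 x * p0 x) + (1 + a x) * (2 * p0 x * a x)
  + 2 * d x * (p0 x * p1 x) + 2 * b x * (a x * p1 x + p0 x * b x)
  - c x * (p1 x * p1 x) - a x * (2 * p1 x * b x).
pose Q1 x := 2 * p1 x * (- (1 + a x) * a x - b x * b x)
  + 2 * u x * (- d x * a x - (1 + a x) * d x + 2 * b x * c x)
  + d x * (p0 x * p0 x) + (1 + a x) * (2 * p0 x * b x)
  - 2 * c x * (p0 x * p1 x) + 2 * b x * (b x * p1 x - p0 x * (1 + a x))
  - d x * (p1 x * p1 x) + a x * (2 * p1 x * (1 + a x)).
have D0 (t : R) : `|t| < r -> is_derive t 1
   (fun s => makar_limanov (z + s *: mkv 1 0) - beta (z + s *: mkv 1 0))
   (Q0 (z + t *: mkv 1 0) - b0 t).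
  move=> tr; have At := nbhs_line r0 n0 rA tr.
  have e1 := line_derive hu At. have e2 := line_derive hp0 At.
  have e3 := line_derive hp1 At. have e4 := line_derive ha At.
  have e5 := line_derive hb At. have e6 := db0 _ tr.
  rewrite /makar_limanov; eapply der_eq; [by der|].
  by rewrite /Q0 !pE; ring.
have D1 (t : R) : `|t| < r -> is_derive t 1
   (fun s => makar_limanov (z + s *: mkv 0 1) - beta (z + s *: mkv 0 1))
   (Q1 (z + t *: mkv 0 1) - b1 t).
  move=> tr; have At := nbhs_line r0 n1 rA tr.
  have e1 := line_derive hu At. have e2 := line_derive hp0 At.
  have e3 := line_derive hp1 At. have e4 := line_derive ha At.
  have e5 := line_derive hb At. have e6 := db1 _ tr.
  rewrite /makar_limanov; eapply der_eq; [by der|].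
  by rewrite /Q1 !pE; ring.
have zr : `|0 : R| < r by rewrite normr0.
pose D00 := - e z - 2 * c z * c z - 2 * a z * e z - 2 * d z * d z - 2 * b z * k z.
pose D11 := e z * (1 + 2 * a z) - 2 * d z * d z - 2 * c z * c z + 2 * b z * k z.
pose Q00 := 2 * a z * (- (1 + a z) * a z - b z * b z)
  + 4 * p0 z * (- c z - 2 * a z * c z - 2 * b z * d z) + 2 * u z * D00
  + (e z * (p0 z * p0 z) + 2 * c z * p0 z * a z + 2 * c z * (1 + 2 * a z) * p0 z
    + 2 * (1 + a z) * a z * a z + 2 * k z * p0 z * p1 z
    + 2 * d z * (a z * p1 z + p0 z * b z) + 4 * b z * d z * p0 z
    + 2 * b z * b z * a z - e z * p1 z * p1 z - 2 * c z * p1 z * b z).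
pose Q11 := 2 * (- 1 - a z) * (- (1 + a z) * a z - b z * b z)
  + 4 * p1 z * (- d z * (1 + 2 * a z) + 2 * b z * c z) + 2 * u z * D11
  + (- e z * p0 z * p0 z + 2 * d z * p0 z * b z - 2 * k z * p0 z * p1 z
    - 2 * c z * (b z * p1 z - p0 z * (1 + a z)) - 4 * b z * c z * p1 z
    - 2 * b z * b z * (1 + a z) + e z * p1 z * p1 z
    + 2 * d z * p1 z * (1 + a z) + 2 * d z * (1 + 2 * a z) * p1 z
    - 2 * a z * (1 + a z) * (1 + a z)).
have z0 v : z + (0 : R) *: v = z by rewrite scale0r addr0.
have T0 : is_derive (0 : R) 1 (fun t => Q0 (z + t *: mkv 1 0) - b0 t) (Q00 - B0).
  have At := nbhs_line r0 n0 rA zr.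
  have e1 := line_derive hu At. have e2 := line_derive hp0 At.
  have e3 := line_derive hp1 At. have e4 := line_derive ha At.
  have e5 := line_derive hb At. have e6 := line_derive hc At.
  have e7 := line_derive hd At.
  rewrite /Q0; eapply der_eq; [by der|].
  by rewrite !pE !z0 /Q00 /D00; ring.
have T1 : is_derive (0 : R) 1 (fun t => Q1 (z + t *: mkv 0 1) - b1 t) (Q11 - B1).
  have At := nbhs_line r0 n1 rA zr.
  have e1 := line_derive hu At. have e2 := line_derive hp0 At.
  have e3 := line_derive hp1 At. have e4 := line_derive ha At.
  have e5 := line_derive hb At. have e6 := line_derive hc At.
  have e7 := line_derive hd At.
  rewrite /Q1; eapply der_eq; [by der|].
  by rewrite !pE !z0 /Q11 /D11; ring.
have mn (v : 'rV[R]_2) (t : R) : `|v| <= 1 -> `|t| < r ->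
   makar_limanov (z + (0 : R) *: v) - beta (z + (0 : R) *: v)
     <= makar_limanov (z + t *: v) - beta (z + t *: v).
  move=> v1 tr; rewrite z0; apply: rmin; rewrite addrC addKr normrZ.
  by apply: le_lt_trans tr; rewrite ler_piMr.
have q0 := second_derivative_test r0 D0 T0 (fun t => mn _ t n0).
have q1 := second_derivative_test r0 D1 T1 (fun t => mn _ t n1).
have E : Q00 + Q11 = - 8 * u z * (c z * c z + d z * d z).
  by rewrite /Q00 /Q11 /D00 /D11; ring.
by rewrite -E; lra.
Qed.

End Jet.

(** * Convexity, closures, compactness and continuity on subsets of the plane *)

Section PlaneTopology.
Variable R : realType.
Implicit Types (A C : set 'rV[R]_2) (x y p v w : 'rV[R]_2) (r s t : R).

Definition cvx A := forall x y t, A x -> A y -> 0 <= t <= 1 ->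
  A (x + t *: (y - x)).

Lemma convex_set_cvx A :
  convex_set (A : set (convex_lmodType 'rV[R]_2)) -> cvx A.
Proof.
move=> cA x y t Ax Ay /andP[t0 t1].
have xA : (x : convex_lmodType 'rV[R]_2) \in (A : set (convex_lmodType 'rV[R]_2)).
  exact/mem_set.
have yA : (y : convex_lmodType 'rV[R]_2) \in (A : set (convex_lmodType 'rV[R]_2)).
  exact/mem_set.
have := cA _ _ (Itv01 t0 t1) yA xA => /set_mem /=.
have -> : x + t *: (y - x) = t *: y + (1 - t) *: x.
  by apply: eq_pxy; rewrite !pE; ring.
by [].
Qed.

Lemma closureP A x :
  closure A x <-> forall r, 0 < r -> exists2 y, A y & `|y - x| < r.
Proof.
split=> [cx r r0|H B /nbhs_normP[r /= r0 rB]].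
  have [|y [Ay /= yr]] := cx (fun y => `|y - x| < r).
    refine ((nbhs_normP x _).2 _); exists r => //= y.
    by rewrite /ball_ /= distrC.
  by exists y.
by have [y Ay yr] := H r r0; exists y; split => //; apply: rB; rewrite /ball_ /= distrC.
Qed.

(** The point [p] is replaced by a nearby [p'] of [A], and [x] by the [x'] that leaves the convex
    combination unchanged; [x'] is in [A] because [A] is open. *)
Lemma open_convex_closure A p x s : open A -> cvx A -> closure A p -> A x ->
  0 < s <= 1 -> A (p + s *: (x - p)).
Proof.
move=> oA cA /closureP clp Ax /andP[s0 s1].
have [r r0 rA] := openP oA Ax.
have e0 : 0 < r * s by rewrite mulr_gt0.
have [p' Ap' pp'] := clp _ e0.
pose x' := x + ((1 - s) / s) *: (p - p').
have Ax' : A x'.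
  apply: rA; rewrite /x' addrC addKr normrZ distrC.
  rewrite ger0_norm ?divr_ge0 ?subr_ge0//; last exact: ltW.
  rewrite mulrAC ltr_pdivrMr//; apply: le_lt_trans pp'.
  by rewrite ler_piMl//; lra.
have := cA p' x' s Ap' Ax'; rewrite s1 ltW// => /(_ isT).
rewrite (_ : _ + _ = p + s *: (x - p))//.
have sn : s != 0 by rewrite gt_eqF.
by apply: eq_pxy; rewrite /x' !pE; field.
Qed.

Lemma closure_cvx A : cvx A -> cvx (closure A).
Proof.
move=> cA x y t /closureP clx /closureP cly t01; apply/closureP => r r0.
have r2 : 0 < r / 2 by rewrite divr_gt0.
have [x' Ax' hx] := clx _ r2; have [y' Ay' hy] := cly _ r2.
exists (x' + t *: (y' - x')); first exact: cA.
rewrite (_ : _ - _ = (1 - t) *: (x' - x) + t *: (y' - y)); last first.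
  by apply: eq_pxy; rewrite !pE; ring.
apply: le_lt_trans (ler_normD _ _) _; rewrite !normrZ !ger0_norm; [|lra..].
have := normr_ge0 (x' - x); have := normr_ge0 (y' - y).
move: t01 => /andP[t0 t1]; nra.
Qed.

Lemma within_continuousP C (g : 'rV[R]_2 -> R) : {within C, continuous g} ->
  forall x, C x -> forall e : R, 0 < e ->
  exists2 r, 0 < r & forall y, C y -> `|y - x| < r -> `|g y - g x| < e.
Proof.
move=> /subspace_continuousP cg x Cx e e0.
have /cvgrPdist_lt /(_ e e0) := cg x Cx.
rewrite near_withinE => /nbhs_normP[r /= r0 rP]; exists r => // y Cy yr.
by rewrite distrC; apply: rP => //; rewrite /ball_ /= distrC.
Qed.

Lemma within_continuous_sub C C' (g : 'rV[R]_2 -> R) : C' `<=` C ->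
  {within C, continuous g} -> {within C', continuous g}.
Proof. by move=> sub; apply: continuous_subspaceW. Qed.

Lemma withinM C (f g : 'rV[R]_2 -> R) : {within C, continuous f} ->
  {within C, continuous g} -> {within C, continuous (fun x => f x * g x)}.
Proof. by move=> cf cg x; apply: cvgM; [exact: cf|exact: cg]. Qed.

Lemma withinD C (f g : 'rV[R]_2 -> R) : {within C, continuous f} ->
  {within C, continuous g} -> {within C, continuous (fun x => f x + g x)}.
Proof. by move=> cf cg x; apply: cvgD; [exact: cf|exact: cg]. Qed.

Lemma withinN C (f : 'rV[R]_2 -> R) : {within C, continuous f} ->
  {within C, continuous (fun x => - f x)}.
Proof. by move=> cf x; apply: cvgN; exact: cf. Qed.

Lemma withinV C (f : 'rV[R]_2 -> R) : (forall x, C x -> f x != 0) ->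
  {within C, continuous f} -> {within C, continuous (fun x => (f x)^-1)}.
Proof.
move=> f0 /subspace_continuousP cf; apply/subspace_continuousP => x Cx.
by apply: cvgV; [exact: f0 | exact: cf].
Qed.

Lemma withinC C (k : R) : {within C, continuous (fun _ : 'rV[R]_2 => k)}.
Proof. by move=> x; apply: cvg_cst. Qed.

Lemma withinx C : {within C, continuous (@px R)}.
Proof. by apply: continuous_subspaceT; exact: px_continuous. Qed.

Lemma withiny C : {within C, continuous (@py R)}.
Proof. by apply: continuous_subspaceT; exact: py_continuous. Qed.

Lemma compact_min C (f : 'rV[R]_2 -> R) : compact C -> C !=set0 ->
  {within C, continuous f} -> exists2 z, C z & forall y, C y -> f z <= f y.
Proof.
move=> cC C0 cf; have [z zC zP] := EVT_min_rV C0 cC cf.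
by exists z => [|y Cy]; [exact/set_mem | apply: zP; exact/mem_set].
Qed.

Lemma compact_max C (f : 'rV[R]_2 -> R) : compact C -> C !=set0 ->
  {within C, continuous f} -> exists2 z, C z & forall y, C y -> f y <= f z.
Proof.
move=> cC C0 cf; have [z zC zP] := EVT_max_rV C0 cC cf.
by exists z => [|y Cy]; [exact/set_mem | apply: zP; exact/mem_set].
Qed.

Lemma continuous_setT (g : 'rV[R]_2 -> R) :
  {within setT, continuous g} -> continuous g.
Proof. exact: (continuous_subspace_setT g).2. Qed.

Lemma closed_le0 (g : 'rV[R]_2 -> R) : {within setT, continuous g} ->
  closed [set x | g x <= 0].
Proof.
move=> /continuous_setT cg.
have -> : [set x | g x <= 0] = g @^-1` [set r | r <= 0] by [].
by apply: preimage_closed => [x _|]; [exact: cg | exact: closed_le].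
Qed.

Lemma closed_eq0 (g : 'rV[R]_2 -> R) : {within setT, continuous g} ->
  closed [set x | g x = 0].
Proof.
move=> /continuous_setT cg.
have -> : [set x | g x = 0] = g @^-1` [set 0] by [].
by apply: preimage_closed => [x _|]; [exact: cg | exact: closed_eq].
Qed.

Lemma bounded_setP A : bounded_set A ->
  exists2 B : R, 0 < B & forall x, A x -> `|x| <= B.
Proof.
move=> [M [_ MP]]; exists (Num.max 1 (M + 1)); first by rewrite lt_max ltr01.
move=> x Ax; apply: MP => //.
by rewrite lt_max; apply/orP; right; rewrite ltrDl.
Qed.

Lemma closure_bounded A (B : R) : (forall x, A x -> `|x| <= B) ->
  forall x, closure A x -> `|x| <= B.
Proof.
move=> bA x /closureP clx; rewrite leNgt; apply/negP => Bx.
have e0 : 0 < `|x| - B by rewrite subr_gt0.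
have [y Ay yx] := clx _ e0; have := bA _ Ay.
by have := ler_normD (x - y) y; rewrite subrK distrC; lra.
Qed.

Lemma closed_bounded_compact C (B : R) : closed C ->
  (forall x, C x -> `|x| <= B) -> compact C.
Proof.
move=> clC bC; apply: bounded_closed_compact => //.
exists B; split; first exact: num_real.
by move=> M BM x Cx; apply: le_trans (bC _ Cx) (ltW BM).
Qed.

End PlaneTopology.

Definition cts_on (R : realType) (C : set 'rV[R]_2) (f : 'rV[R]_2 -> R) :=
  {within C, continuous f}.

Lemma cts_onI (R : realType) (C : set 'rV[R]_2) (f : 'rV[R]_2 -> R) :
  cts_on C f -> {within C, continuous f}.
Proof. by []. Qed.

(* Unifying a sum with a product in the algebraic hierarchy is very slow, hence
   the syntactic dispatch. *)
Ltac cont_rec := lazymatch goal with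
  | |- cts_on ?C (fun x => @?f x + @?g x) =>
      refine (@withinD _ _ f g _ _); [change (cts_on C f)|change (cts_on C g)];
      cbv beta; cont_rec
  | |- cts_on ?C (fun x => @?f x * @?g x) =>
      refine (@withinM _ _ f g _ _); [change (cts_on C f)|change (cts_on C g)];
      cbv beta; cont_rec
  | |- cts_on ?C (fun x => - @?f x) =>
      refine (@withinN _ _ f _); change (cts_on C f); cbv beta; cont_rec
  | |- cts_on _ (fun x => px x) => exact: withinx
  | |- cts_on _ (fun x => py x) => exact: withiny
  | |- cts_on _ (fun _ => ?k) => exact: withinC
  | |- _ => unfold cts_on; eassumption
  end.
Ltac cont := apply: cts_onI; cont_rec.

Section Calculus2.
Variable R : realType.
Implicit Types (A : set 'rV[R]_2).

Lemma MVT_grad A (f g0 g1 : 'rV[R]_2 -> R) y w : has_grad A f g0 g1 ->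
  (forall t : R, 0 <= t <= 1 -> A (y + t *: w)) ->
  exists2 t : R, 0 < t < 1 &
    f (y + w) - f y = g0 (y + t *: w) * px w + g1 (y + t *: w) * py w.
Proof.
move=> hf hA.
have [t /hA At|t tI E] := @MVT01 R (fun t => f (y + t *: w))
   (fun t => g0 (y + t *: w) * px w + g1 (y + t *: w) * py w).
  exact: line_derive hf At.
by exists t => //; rewrite -E scale1r scale0r addr0.
Qed.

Lemma line_small (v : 'rV[R]_2) (r : R) : 0 < r ->
  exists2 r' : R, 0 < r' & forall s : R, `|s| < r' -> `|s *: v| < r.
Proof.
move=> r0; have v0 : 0 < `|v| + 1 by rewrite ltr_wpDl.
exists (r / (`|v| + 1)); first by rewrite divr_gt0.
move=> s; rewrite ltr_pdivlMr// => hs; rewrite normrZ; apply: le_lt_trans hs.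
by rewrite ler_wpM2l// lerDl.
Qed.

(** Squared Euclidean distance: unlike the sup norm it is a polynomial, so it can enter comparison
    functions that are differentiated twice. *)
Definition sqdist (p x : 'rV[R]_2) : R :=
  (px x - px p) * (px x - px p) + (py x - py p) * (py x - py p).

Lemma sqdist_cont C p : {within C, continuous (sqdist p)}.
Proof. by rewrite /sqdist; cont. Qed.

Lemma sqdist_norm p x (r : R) : 0 <= r -> sqdist p x <= r * r -> `|x - p| <= r.
Proof.
move=> r0 h; rewrite norm_pxy !pE ge_max; move: h; rewrite /sqdist.
set X := px x - px p; set Y := py x - py p => h.
by apply/andP; split; rewrite ler_norml; nra.
Qed.

Lemma sqdist0 p : sqdist p p = 0.
Proof. by rewrite /sqdist; ring. Qed.

End Calculus2.

(** * Positivity of u and of Q in the domain *)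

Section Torsion.
Variables (R : realType) (Om : set 'rV[R]_2).
Variables (u p0 p1 a b c d e k : 'rV[R]_2 -> R).
Hypothesis oOm : open Om.
Hypothesis cOm : cvx Om.
Hypothesis scOm : forall x y, x <> y -> ~ segment x y `<=` frontier Om.
Hypothesis conOm : connected Om.
Variable B : R.
Hypothesis bOm : forall x, Om x -> `|x| <= B.
Hypothesis hu : has_grad Om u p0 p1.
Hypothesis hp0 : has_grad Om p0 a b.
Hypothesis hp1 : has_grad Om p1 b (fun x => - 1 - a x).
Hypothesis ha : has_grad Om a c d.
Hypothesis hb : has_grad Om b d (fun x => - c x).
Hypothesis hc : has_grad Om c e k.
Hypothesis hd : has_grad Om d k (fun x => - e x).
Hypothesis cu : {within closure Om, continuous u}.
Hypothesis u0 : forall x, frontier Om x -> u x = 0.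
(** Continuous extensions to the closure of u_1, u_2, u_11 and u_12; through them Q acquires values
    on the frontier. *)
Variables (E0 E1 Ea Eb : 'rV[R]_2 -> R).
Hypothesis cE0 : {within closure Om, continuous E0}.
Hypothesis cE1 : {within closure Om, continuous E1}.
Hypothesis cEa : {within closure Om, continuous Ea}.
Hypothesis cEb : {within closure Om, continuous Eb}.
Hypothesis EE0 : forall x, Om x -> E0 x = p0 x.
Hypothesis EE1 : forall x, Om x -> E1 x = p1 x.
Hypothesis EEa : forall x, Om x -> Ea x = a x.
Hypothesis EEb : forall x, Om x -> Eb x = b x.

Lemma Om_closure x : Om x -> closure Om x.
Proof. exact: subset_closure. Qed.

Lemma closure_cases x : closure Om x -> Om x \/ frontier Om x.
Proof.
move=> cx; have [Ox|Ox] := pselect (Om x); [by left|right].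
by split => //; rewrite (interior_id Om).1.
Qed.

Lemma frontierI x : closure Om x -> ~ Om x -> frontier Om x.
Proof. by move=> /closure_cases[]. Qed.

Lemma frontier_closure x : frontier Om x -> closure Om x.
Proof. by case. Qed.

Lemma compact_closure : compact (closure Om).
Proof.
apply: closed_bounded_compact; first exact: closed_closure.
exact: closure_bounded bOm.
Qed.

(** Both u_11 and u_22 would be nonnegative at [z], whereas their sum is - 1. *)
Lemma torsion_no_local_min z (r : R) : 0 < r ->
  (forall y, `|y - z| < r -> Om y) ->
  (forall y, `|y - z| < r -> u z <= u y) -> False.
Proof.
move=> r0 rO rmin.
have n0 : `|mkv 1 0 : 'rV[R]_2| <= 1.
  by rewrite norm_pxy !pE normr1 normr0 ge_max lexx ler01.
have n1 : `|mkv 0 1 : 'rV[R]_2| <= 1.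
  by rewrite norm_pxy !pE normr1 normr0 ge_max lexx ler01.
have z0 v : z + (0 : R) *: v = z by rewrite scale0r addr0.
have zr : `|0 : R| < r by rewrite normr0.
have mn (v : 'rV[R]_2) (t : R) : `|v| <= 1 -> `|t| < r ->
    u (z + (0 : R) *: v) <= u (z + t *: v).
  move=> v1 tr; rewrite z0; apply: rmin; rewrite addrC addKr normrZ.
  by apply: le_lt_trans tr; rewrite ler_piMr.
have D0 (t : R) : `|t| < r -> is_derive t 1 (fun s => u (z + s *: mkv 1 0))
   (p0 (z + t *: mkv 1 0)).
  move=> tr; have At := nbhs_line r0 n0 rO tr.
  apply: der_eq (line_derive hu At) _; rewrite !pE; ring.
have D1 (t : R) : `|t| < r -> is_derive t 1 (fun s => u (z + s *: mkv 0 1))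
   (p1 (z + t *: mkv 0 1)).
  move=> tr; have At := nbhs_line r0 n1 rO tr.
  apply: der_eq (line_derive hu At) _; rewrite !pE; ring.
have T0 := line_derive hp0 (nbhs_line r0 n0 rO zr).
have T1 := line_derive hp1 (nbhs_line r0 n1 rO zr).
have := second_derivative_test r0 D0 T0 (fun t => mn _ t n0).
have := second_derivative_test r0 D1 T1 (fun t => mn _ t n1).
rewrite !pE !z0; lra.
Qed.

(** The minimum over the compact closure is attained on the frontier, hence is 0; a point of [Om]
    with u <= 0 would be an interior minimum. *)
Lemma torsion_gt0 x : Om x -> 0 < u x.
Proof.
move=> Ox; have clx := Om_closure Ox.
have [z clz zmin] := compact_min compact_closure (ex_intro _ x clx) cu.
have noz : ~ Om z.
  move=> Oz; have [r r0 rO] := openP oOm Oz.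
  apply: (torsion_no_local_min r0 rO) => y /rO Oy.
  exact/zmin/Om_closure.
have uz : u z = 0 by apply: u0; apply: frontierI.
rewrite ltNge; apply/negP => ux; have [r r0 rO] := openP oOm Ox.
apply: (torsion_no_local_min r0 rO) => y /rO Oy.
by apply: le_trans ux _; rewrite -uz; exact/zmin/Om_closure.
Qed.

Let mlE := makar_limanov u E0 E1 Ea Eb.
Let mlO := makar_limanov u p0 p1 a b.

Lemma mlE_eq x : Om x -> mlE x = mlO x.
Proof. by move=> Ox; rewrite /mlE /mlO /makar_limanov EE0// EE1// EEa// EEb. Qed.

Lemma mlE_cont : {within closure Om, continuous mlE}.
Proof. by rewrite /mlE /makar_limanov; cont. Qed.

(* If the inequality fails at [p], the second derivative of [u] along the
   tangent at [p] is positive near [p].  Since the closure of [Om] touches that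
   tangent line only at [p], short chords parallel to it stay near [p], and the
   maximum of [u] on such a chord is interior: a contradiction. *)
Lemma ml_frontier_ge0 p : frontier Om p -> 0 <= mlE p.
Proof.
move=> fp; rewrite leNgt; apply/negP => neg.
have clp := frontier_closure fp; have up := u0 fp.
pose g0 := E0 p; pose g1 := E1 p.
(* As u vanishes at [p], a zero gradient would give Q = 0 there. The assumption Q < 0 thus does the
   work of a boundary point lemma. *)
have gg : 0 < g0 * g0 + g1 * g1.
  rewrite lt_neqAle eq_sym; apply/andP; split; last by nra.
  apply/negP => /eqP g00; have gz : g0 = 0 /\ g1 = 0 by split; nra.
  by move: neg; rewrite /mlE /makar_limanov up -/g0 -/g1 gz.1 gz.2; lra.
(* Second derivative of u along the fixed vector (- [g1], [g0]), tangent at [p]; at [p] itself it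
   equals - Q. *)
pose D x := Ea x * (g1 * g1) - 2 * Eb x * (g0 * g1) + (- 1 - Ea x) * (g0 * g0).
have cD : {within closure Om, continuous D} by rewrite /D; cont.
have Dp : 0 < D p.
  by move: neg; rewrite /mlE /makar_limanov up -/g0 -/g1 /D; lra.
have [r r0 rD] := within_continuousP cD clp Dp.
have {}rD y : Om y -> `|y - p| < r -> 0 < D y.
  by move=> /Om_closure cy /rD => /(_ cy); rewrite ltr_norml; lra.
pose n x := g0 * (px x - px p) + g1 * (py x - py p).
have cn C : {within C, continuous n} by rewrite /n; cont.
have np : n p = 0 by rewrite /n; ring.
(* For a point [x] below the tangent line, u would decrease along the segment entering [Om] from
   [p], although it starts from 0 and is positive in [Om]. *)
have nge x : Om x -> 0 <= n x.
  move=> Ox; rewrite leNgt; apply/negP => nx.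
  pose w := x - p.
  pose G y := E0 y * px w + E1 y * py w.
  have cG : {within closure Om, continuous G} by rewrite /G; cont.
  have Gp : 0 < - G p.
    by move: nx; rewrite /n /G /w !pE -/g0 -/g1; lra.
  have [r' r'0 r'G] := within_continuousP cG clp Gp.
  have {}r'G y : Om y -> `|y - p| < r' -> p0 y * px w + p1 y * py w < 0.
    move=> Oy yr; have := r'G y (Om_closure Oy) yr.
    by rewrite /G EE0// EE1// ltr_norml; lra.
  have [r1 r10 r1P] := line_small w r'0.
  pose s := Num.min r1 1 / 2.
  have m0 : 0 < Num.min r1 1 by rewrite lt_min r10 ltr01.
  have s0 : 0 < s by rewrite /s; lra.
  have [sr s1] : s < r1 /\ s < 1.
    by apply/andP; rewrite -lt_min /s; lra.
  have Os (t : R) : 0 < t <= 1 -> Om (p + t *: w).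
    exact: open_convex_closure.
  have us : 0 < u (p + s *: w) by apply: torsion_gt0; apply: Os; lra.
  have [r2 r20 r2P] := within_continuousP cu clp us.
  have [r3 r30 r3P] := line_small w r20.
  pose t := Num.min r3 s / 2.
  have m1 : 0 < Num.min r3 s by rewrite lt_min r30.
  have t0 : 0 < t by rewrite /t; lra.
  have [tr ts] : t < r3 /\ t < s.
    by apply/andP; rewrite -lt_min /t; lra.
  have shift (z : R) : p + t *: w + z *: ((s - t) *: w)
      = p + (t + z * (s - t)) *: w.
    by apply: eq_pxy; rewrite !pE; ring.
  have [z zI|z zI] := @MVT_grad R Om u p0 p1 (p + t *: w) ((s - t) *: w) hu.
    by rewrite shift; apply: Os; nra.
  rewrite shift (_ : p + t *: w + (s - t) *: w = p + s *: w); last first.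
    by apply: eq_pxy; rewrite !pE; ring.
  have zz : 0 < t + z * (s - t) < s by nra.
  have : p0 (p + (t + z * (s - t)) *: w) * px w
     + p1 (p + (t + z * (s - t)) *: w) * py w < 0.
    apply: r'G; first by apply: Os; lra.
    by rewrite addrC addKr; apply: r1P; rewrite gtr0_norm; lra.
  have : `|u (p + t *: w) - u p| < u (p + s *: w).
    apply: r2P; first by apply/Om_closure/Os; lra.
    by rewrite addrC addKr; apply: r3P; rewrite gtr0_norm.
  rewrite up subr0 ltr_norml !pE => /andP[_ A1] A2 A3.
  have st : 0 < s - t by lra.
  move: A1 A2 A3 st; nra.
have ngt x : Om x -> 0 < n x.
  move=> Ox; rewrite lt_neqAle eq_sym nge// andbT; apply/negP => /eqP nx.
  have [r1 r10 r1P] := openP oOm Ox.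
  have [r2 r20 r2P] := line_small (mkv g0 g1) r10.
  have : Om (x + (- (r2 / 2)) *: mkv g0 g1).
    apply: r1P; rewrite addrC addKr; apply: r2P.
    by rewrite normrN gtr0_norm; lra.
  move/nge; move: nx; rewrite /n !pE; nra.
have clge y : closure Om y -> 0 <= n y.
  move=> cy; rewrite leNgt; apply/negP => ny.
  have ny' : 0 < - n y by lra.
  have [r1 r10 r1P] := within_continuousP (cn setT) (I : setT y) ny'.
  have [y' /ngt Oy' yy'] := (closureP Om y).1 cy r1 r10.
  by have := r1P y' I yy'; rewrite ltr_norml; lra.
(* A second contact point [y] would place the whole segment from [p] to [y] on the frontier, against
   strict convexity. *)
have clgt y : closure Om y -> y <> p -> 0 < n y.
  move=> cy yp; rewrite lt_neqAle eq_sym clge// andbT; apply/negP => /eqP ny.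
  apply: (@scOm p y) => [E|_ [t /= tI <-]]; first by rewrite E in yp.
  have t01 : 0 <= t <= 1 by move: tI; rewrite in_itv.
  have -> : (1 - t) *: p + t *: y = p + t *: (y - p).
    by apply: eq_pxy; rewrite !pE; ring.
  apply: frontierI; first exact: (closure_cvx cOm).
  move=> /ngt; move: ny; rewrite /n !pE; nra.
pose rho := r / 2.
have rho0 : 0 < rho by rewrite divr_gt0.
have rhor : rho < r by rewrite ltr_pdivrMr// ltr_pMr// ltr1n.
have rr0 : 0 < rho * rho by rewrite mulr_gt0.
(* On the circle of radius [rho] the height [n] has a lower bound [eta] > 0, so a chord of height
   less than [eta], cut by the disc, does not reach the circle. *)
pose S := closure Om `&` [set z | sqdist p z - rho * rho = 0].
have cS : compact S.
  apply: compact_closedI; first exact: compact_closure.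
  by apply: closed_eq0; have h := @sqdist_cont R setT p; cont.
have [eta eta0 etaP] : exists2 eta : R, 0 < eta & forall z, S z -> eta <= n z.
  have [S0|S0] := pselect (S !=set0).
    have [z [cz /= ez] zP] := compact_min cS S0 (cn S).
    exists (n z) => //; apply: clgt => // zp.
    by move: ez; rewrite zp sqdist0; lra.
  by exists 1 => // z Sz; case: S0; exists z.
have [ra ra0 raP] := within_continuousP (@sqdist_cont R setT p) (I : setT p) rr0.
have [rb rb0 rbP] := within_continuousP (cn setT) (I : setT p) eta0.
have rab : 0 < Num.min ra rb by rewrite lt_min ra0.
have [x Ox] := (closureP Om p).1 clp _ rab.
rewrite lt_min => /andP[/(raP x I) xa /(rbP x I) xb].
have {}xa : sqdist p x < rho * rho.
  by move: xa; rewrite sqdist0 ltr_norml; lra.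
have {}xb : n x < eta by move: xb; rewrite np ltr_norml; lra.
pose C := (closure Om `&` [set z | sqdist p z - rho * rho <= 0])
   `&` [set z | n z - n x = 0].
have cC : compact C.
  apply: compact_closedI; last by apply: closed_eq0; have h := cn setT; cont.
  apply: compact_closedI; first exact: compact_closure.
  by apply: closed_le0; have h := @sqdist_cont R setT p; cont.
have Cx : C x by split; [split; [exact: Om_closure|rewrite /=; lra]|rewrite /=; lra].
have cuC : {within C, continuous u}.
  by apply: within_continuous_sub cu => y [[]].
have [z [[clz /= ez] /= nz] zmax] := compact_max cC (ex_intro _ x Cx) cuC.
have uz : 0 < u z by apply: lt_le_trans (torsion_gt0 Ox) (zmax _ Cx).
have Oz : Om z.
  by case: (closure_cases clz) => // /u0 uz0; rewrite uz0 ltxx in uz.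
have ez' : sqdist p z < rho * rho.
  rewrite lt_neqAle; apply/andP; split; last by lra.
  apply/negP => /eqP E; have : S z by split => //=; rewrite E subrr.
  by move/etaP; lra.
have [s1 s10 s1P] := openP oOm Oz.
have ez0 : 0 < rho * rho - sqdist p z by lra.
have [s2 s20 s2P] := within_continuousP (@sqdist_cont R setT p) (I : setT z) ez0.
have s12 : 0 < Num.min s1 s2 by rewrite lt_min s10.
pose v := mkv (- g1) g0.
have [s s0 sP] := line_small v s12.
have inO (t : R) : `|t| < s -> Om (z + t *: v) /\ C (z + t *: v).
  move=> /sP; rewrite lt_min => /andP[h1 h2].
  have O : Om (z + t *: v) by apply: s1P; rewrite addrC addKr.
  have : `|z + t *: v - z| < s2 by rewrite addrC addKr.
  move=> /(s2P _ I); rewrite ltr_norml => /andP[_ h3].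
  split => //; split; first by split; [exact: Om_closure|rewrite /=; lra].
  by move: nz; rewrite /= /n !pE => nz; rewrite -[RHS]nz; ring.
have D0 (t : R) : `|t| < s -> is_derive t 1 (fun y => - u (z + y *: v))
    (g1 * p0 (z + t *: v) - g0 * p1 (z + t *: v)).
  move=> /inO[Ot _]; apply: der_eq (derN (line_derive hu Ot)) _.
  by rewrite !pE; ring.
have z0 : z + (0 : R) *: v = z by rewrite scale0r addr0.
have D1 : is_derive (0 : R) 1
    (fun t => g1 * p0 (z + t *: v) - g0 * p1 (z + t *: v)) (- D z).
  have Oz0 : Om (z + (0 : R) *: v) by rewrite z0.
  have e1 := line_derive hp0 Oz0; have e2 := line_derive hp1 Oz0.
  eapply der_eq; [by der|].
  by rewrite !pE !z0 /D EEa// EEb//; ring.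
have zr := le_lt_trans (sqdist_norm (ltW rho0) (ltW ez')) rhor.
have Dz := rD _ Oz zr.
have mn (t : R) : `|t| < s -> - u (z + (0 : R) *: v) <= - u (z + t *: v).
  by move=> /inO[_ Ct]; rewrite z0 lerN2; exact: zmax.
by have := second_derivative_test s0 D0 D1 mn; lra.
Qed.

(** Weak minimum principle. Lap Q <= 0 alone is compatible with an interior minimum; subtracting
    [ep] |y|^2, whose Laplacian is 4 [ep] > 0, makes one impossible. *)
Lemma ml_ge0 x : Om x -> 0 <= mlO x.
Proof.
move=> Ox; rewrite leNgt; apply/negP => neg.
have clx := Om_closure Ox.
pose q (y : 'rV[R]_2) := px y * px y + py y * py y.
have B0 : 0 <= B by apply: le_trans (bOm Ox).
have qB y : closure Om y -> 0 <= q y <= 2 * (B * B).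
  move=> cy; have yB := closure_bounded bOm cy.
  have := le_trans (px_le_norm y) yB; have := le_trans (py_le_norm y) yB.
  rewrite !ler_norml /q; move: B0; move: (px y) (py y) => X Y; nra.
(* So small that the minimum of [W] lies below - 2 [ep] [B]^2, a lower bound for [W] on the
   frontier. *)
pose ep := - mlO x / (4 * (B * B) + 2).
have BB : 0 < 4 * (B * B) + 2 by nra.
have ep0 : 0 < ep by rewrite divr_gt0//; lra.
have epE : ep * (4 * (B * B) + 2) = - mlO x.
  by rewrite /ep divfK// gt_eqF.
pose W y := mlE y - ep * q y.
have cW : {within closure Om, continuous W}.
  by have := mlE_cont; rewrite /W /q => h; cont.
have [z clz zmin] := compact_min compact_closure (ex_intro _ x clx) cW.
have Wz : W z < - (ep * (2 * (B * B))).
  apply: le_lt_trans (zmin _ clx) _; rewrite /W mlE_eq//.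
  have := qB _ clx; move: ep0 epE; move: (q x) => X; nra.
have Oz : Om z.
  case: (closure_cases clz) => // fz; have := ml_frontier_ge0 fz.
  move: Wz (qB _ clz) ep0; rewrite /W.
  move: (mlE z) (q z) (B * B) => X Y Z; nra.
have [r r0 rO] := openP oOm Oz.
have db0 (t : R) : `|t| < r ->
   is_derive t 1 (fun s => ep * q (z + s *: mkv 1 0)) (2 * ep * (px z + t)).
  move=> _; rewrite /q; under eq_fun do rewrite !pE.
  by eapply der_eq; [by der|rewrite /=; ring].
have dB0 : is_derive (0 : R) 1 (fun t => 2 * ep * (px z + t)) (2 * ep).
  by eapply der_eq; [by der|rewrite /=; ring].
have db1 (t : R) : `|t| < r ->
   is_derive t 1 (fun s => ep * q (z + s *: mkv 0 1)) (2 * ep * (py z + t)).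
  move=> _; rewrite /q; under eq_fun do rewrite !pE.
  by eapply der_eq; [by der|rewrite /=; ring].
have dB1 : is_derive (0 : R) 1 (fun t => 2 * ep * (py z + t)) (2 * ep).
  by eapply der_eq; [by der|rewrite /=; ring].
have mn y : `|y - z| < r -> mlO z - ep * q z <= mlO y - ep * q y.
  move=> /rO Oy; rewrite -!mlE_eq//; exact/zmin/Om_closure.
have := ml_local_min hu hp0 hp1 ha hb hc hd Oz r0 rO mn db0 dB0 db1 dB1.
have := torsion_gt0 Oz; move: ep0.
move: (u z) (c z) (d z) => U C D; nra.
Qed.


(** Strong minimum principle on a disc. On an annulus about [y0], Q is compared with a multiple of 1
    / |y - y0|^2 - 1 / rho^2, which vanishes on the outer circle and whose Laplacian is a positive
    multiple of 4 / |y - y0|^4. A negative minimum of the difference can be neither interior nor on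
    one of the two circles. *)
Lemma ml_gt0_ball y0 (rho : R) : Om y0 -> 0 < mlO y0 -> 0 < rho ->
  (forall y, sqdist y0 y <= rho * rho -> Om y) ->
  forall y, sqdist y0 y < rho * rho -> 0 < mlO y.
Proof.
move=> Oy0 my0 rho0 rhoO y yrho.
have Oy : Om y by apply: rhoO; exact: ltW.
have cly0 := Om_closure Oy0.
pose eta := mlO y0 / 2.
have eta0 : 0 < eta by rewrite /eta; lra.
have [r1 r10 r1P] := within_continuousP mlE_cont cly0 eta0.
pose r := Num.min r1 rho / 2.
have m0 : 0 < Num.min r1 rho by rewrite lt_min r10.
have r0 : 0 < r by rewrite /r; lra.
have [rr1 rrho] : r < r1 /\ r < rho.
  by apply/andP; rewrite -lt_min /r; lra.
have rr0 : 0 < r * r by rewrite mulr_gt0.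
have rrr : r * r < rho * rho by nra.
have small z : sqdist y0 z <= r * r -> eta < mlO z.
  move=> h; have Oz : Om z by apply: rhoO; lra.
  have zr : `|z - y0| < r1 by apply: le_lt_trans rr1; apply: sqdist_norm; lra.
  have := r1P z (Om_closure Oz) zr; rewrite !mlE_eq// ltr_norml /eta; lra.
have [/small|yr] := lerP (sqdist y0 y) (r * r); first by lra.
rewrite ltNge; apply/negP => my.
(* With this factor [beta] is less than [eta] on the inner circle, where Q exceeds [eta]. *)
pose ep := eta * (r * r).
have ep0 : 0 < ep by rewrite mulr_gt0.
pose C := (closure Om `&` [set z | r * r - sqdist y0 z <= 0])
  `&` [set z | sqdist y0 z - rho * rho <= 0].
have sc : {within setT, continuous (sqdist y0)} by exact: sqdist_cont.
have cC : compact C.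
  apply: compact_closedI; last by apply: closed_le0; cont.
  apply: compact_closedI; first exact: compact_closure.
  by apply: closed_le0; cont.
have Cy : C y by split; [split; [exact: Om_closure|rewrite /=; lra]|rewrite /=; lra].
pose beta z := ep * ((sqdist y0 z)^-1 - (rho * rho)^-1).
pose W z := mlE z - beta z.
have cW : {within C, continuous W}.
  have h1 : {within C, continuous mlE}.
    by apply: within_continuous_sub mlE_cont => z [[]].
  have h2 : {within C, continuous (fun z => (sqdist y0 z)^-1)}.
    apply: withinV; last exact: sqdist_cont.
    by move=> z [[_ /= h] _]; rewrite gt_eqF//; lra.
  by rewrite /W /beta; cont.
have [z Cz zmin] := compact_min cC (ex_intro _ y Cy) cW.
have [[clz /= rz] /= rhoz] := Cz.
have Oz : Om z by apply: rhoO; lra.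
have bpos z' : 0 < sqdist y0 z' -> sqdist y0 z' < rho * rho -> 0 < beta z'.
  by move=> h1 h2; rewrite mulr_gt0// subr_gt0 ltf_pV2// ?posrE; lra.
have Wz : W z < 0.
  apply: le_lt_trans (zmin _ Cy) _; rewrite /W mlE_eq//.
  by have := bpos y; lra.
have rz' : r * r < sqdist y0 z.
  rewrite lt_neqAle; apply/andP; split; last by lra.
  apply/negP => /eqP E; have : eta < mlO z by apply: small; rewrite E.
  move: Wz; rewrite /W /beta mlE_eq// -E /ep mulrBr.
  rewrite -mulrA divff ?gt_eqF// mulr1.
  have : 0 < eta * (r * r) * (rho * rho)^-1.
    by rewrite mulr_gt0// invr_gt0 mulr_gt0.
  lra.
have rhoz' : sqdist y0 z < rho * rho.
  rewrite lt_neqAle; apply/andP; split; last by lra.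
  apply/negP => /eqP E; move: Wz; rewrite /W /beta mlE_eq// E subrr mulr0.
  by have := ml_ge0 Oz; lra.
have [s1 s10 s1P] := openP oOm Oz.
pose mg := Num.min (rho * rho - sqdist y0 z) (sqdist y0 z - r * r).
have mg0 : 0 < mg by rewrite lt_min; lra.
have [s2 s20 s2P] := within_continuousP sc (I : setT z) mg0.
pose s := Num.min s1 s2.
have s0 : 0 < s by rewrite lt_min s10.
have nbC z' : `|z' - z| < s -> C z'.
  rewrite lt_min => /andP[/s1P Oz' /(s2P _ I)].
  rewrite lt_min !ltr_norml => h.
  by split; [split; [exact: Om_closure|rewrite /=; lra]|rewrite /=; lra].
have nbO z' : `|z' - z| < s -> Om z'.
  by rewrite lt_min => /andP[/s1P].
have mn z' : `|z' - z| < s -> mlO z - beta z <= mlO z' - beta z'.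
  by move=> h; rewrite -!mlE_eq//; [exact/zmin/nbC|exact: nbO].
pose q0 (t : R) := sqdist y0 (z + t *: mkv 1 0).
pose q1 (t : R) := sqdist y0 (z + t *: mkv 0 1).
have n0 : `|mkv 1 0 : 'rV[R]_2| <= 1.
  by rewrite norm_pxy !pE normr1 normr0 ge_max lexx ler01.
have n1 : `|mkv 0 1 : 'rV[R]_2| <= 1.
  by rewrite norm_pxy !pE normr1 normr0 ge_max lexx ler01.
have Cq v (t : R) : `|v| <= 1 -> `|t| < s -> sqdist y0 (z + t *: v) != 0.
  move=> v1 ts; have [] := nbC (z + t *: v); last first.
    by move=> [_ /= h] _; rewrite gt_eqF// (lt_le_trans rr0)// -subr_le0.
  rewrite addrC addKr normrZ; apply: le_lt_trans ts.
  by rewrite ler_piMr.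
have dq0 (t : R) : is_derive t 1 q0 (2 * (px z + t - px y0)).
  rewrite /q0 /sqdist; under eq_fun do rewrite !pE.
  by eapply der_eq; [by der|rewrite /=; ring].
have dq1 (t : R) : is_derive t 1 q1 (2 * (py z + t - py y0)).
  rewrite /q1 /sqdist; under eq_fun do rewrite !pE.
  by eapply der_eq; [by der|rewrite /=; ring].
have zs : `|0 : R| < s by rewrite normr0.
pose b0 (t : R) := - 2 * ep * (px z + t - px y0) * ((q0 t)^-1 * (q0 t)^-1).
pose b1 (t : R) := - 2 * ep * (py z + t - py y0) * ((q1 t)^-1 * (q1 t)^-1).
have db0 (t : R) : `|t| < s ->
   is_derive t 1 (fun y => beta (z + y *: mkv 1 0)) (b0 t).
  move=> ts; have e1 := derV (Cq _ _ n0 ts : q0 t != 0) (dq0 t).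
  rewrite /beta; eapply der_eq; [by der|].
  by rewrite /b0 expr2 invfM /=; ring.
have db1 (t : R) : `|t| < s ->
   is_derive t 1 (fun y => beta (z + y *: mkv 0 1)) (b1 t).
  move=> ts; have e1 := derV (Cq _ _ n1 ts : q1 t != 0) (dq1 t).
  rewrite /beta; eapply der_eq; [by der|].
  by rewrite /b1 expr2 invfM /=; ring.
pose q := sqdist y0 z.
have q0p : 0 < q by exact: lt_trans rr0 rz'.
have qn : q != 0 by rewrite gt_eqF.
have q00 : q0 0 = q by rewrite /q0 scale0r addr0.
have q10 : q1 0 = q by rewrite /q1 scale0r addr0.
have dB0 : is_derive (0 : R) 1 b0 (- 2 * ep * (q^-1 * q^-1)
    + 8 * ep * ((px z - px y0) * (px z - px y0)) * (q^-1 * q^-1 * q^-1)).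
  have e1 := derV (Cq _ _ n0 zs : q0 0 != 0) (dq0 0).
  rewrite /b0; eapply der_eq; [by der|].
  by rewrite !q00 addr0 expr2 invfM /=; ring.
have dB1 : is_derive (0 : R) 1 b1 (- 2 * ep * (q^-1 * q^-1)
    + 8 * ep * ((py z - py y0) * (py z - py y0)) * (q^-1 * q^-1 * q^-1)).
  have e1 := derV (Cq _ _ n1 zs : q1 0 != 0) (dq1 0).
  rewrite /b1; eapply der_eq; [by der|].
  by rewrite !q10 addr0 expr2 invfM /=; ring.
have := ml_local_min hu hp0 hp1 ha hb hc hd Oz s0 nbO mn db0 dB0 db1 dB1.
set LHS := (X in X <= _).
have -> : LHS = 4 * ep * (q^-1 * q^-1).
  rewrite /LHS.
  have E : (px z - px y0) * (px z - px y0) + (py z - py y0) * (py z - py y0) = q.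
    by [].
  transitivity (- 4 * ep * (q^-1 * q^-1) + 8 * ep *
    ((px z - px y0) * (px z - px y0) + (py z - py y0) * (py z - py y0)) *
      (q^-1 * q^-1 * q^-1)); first by ring.
  by rewrite E; field.
have uz := torsion_gt0 Oz.
have q0' : 0 < q^-1 by rewrite invr_gt0.
have : 0 < 4 * ep * (q^-1 * q^-1).
  by apply: mulr_gt0; [apply: mulr_gt0|exact: mulr_gt0].
have : 0 <= u z * (c z * c z + d z * d z).
  apply: mulr_ge0; first exact: ltW.
  by rewrite addr_ge0// -expr2 sqr_ge0.
by rewrite -mulrA; lra.
Qed.

(** The set where Q > 0 is open, and it is closed relative to [Om]: a limit point lies in a disc
    inside [Om] centred at a point where Q > 0. *)
Lemma ml_gt0_connected x y : Om x -> 0 < mlO x -> Om y -> 0 < mlO y.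
Proof.
move=> Ox mx Oy; pose P := [set z | Om z /\ 0 < mlO z].
have oP : open P.
  rewrite openE => z [Oz mz].
  have [r1 r10 r1P] := openP oOm Oz.
  have [r2 r20 r2P] := within_continuousP mlE_cont (Om_closure Oz)
    (mz : 0 < mlO z).
  refine ((nbhs_normP z _).2 _).
  exists (Num.min r1 r2); first by rewrite /= lt_min r10.
  move=> w /=; rewrite distrC lt_min => /andP[/r1P Ow].
  move=> /(r2P w (Om_closure Ow)); rewrite !mlE_eq// ltr_norml => h.
  by split => //; lra.
suff E : P = Om by have [] : P y by rewrite E.
apply: conOm; first by exists x.
  by exists P => //; apply/seteqP; split => [z [? ?]//|z []].
exists (closure P); first exact: closed_closure.
apply/seteqP; split => [z Pz|z [Oz clz]].
  by split; [exact: Pz.1 | exact: subset_closure].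
split => //; have [r r0 rO] := openP oOm Oz.
(* Sup distance less than r / 4 puts [z] in the Euclidean disc of radius r / 2 about [w], and this
   disc stays within r of [z]. *)
have r4 : 0 < r / 4 by lra.
have [w [Ow mw] wz] := (closureP P z).1 clz _ r4.
have r2 : 0 < r / 2 by lra.
apply: (ml_gt0_ball Ow mw r2) => [v hv|].
  apply: rO; have := sqdist_norm (ltW r2) hv.
  by have := ler_normD (v - w) (w - z); rewrite addrA subrK; lra.
move: wz; rewrite norm_lt !pE !ltr_norml /sqdist.
move: (px w) (px z) (py w) (py z) => *; nra.
Qed.

(** Only the derivative along y - x has to vanish, so that this covers u_11 and u_12, whose
    gradients vanish, as well as u_1 and u_2 along a kernel direction of the Hessian. *)
Lemma grad_const f f0 f1 x y : has_grad Om f f0 f1 -> Om x -> Om y ->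
  (forall z, Om z -> f0 z * px (y - x) + f1 z * py (y - x) = 0) -> f y = f x.
Proof.
move=> hf Ox Oy h.
have [t t01|t t01] := @MVT_grad R Om f f0 f1 x (y - x) hf; first exact: cOm.
have Ot : Om (x + t *: (y - x)) by apply: cOm => //; lra.
by rewrite h// (addrC x) subrK => /eqP; rewrite subr_eq0 => /eqP.
Qed.

Lemma grad0_max x v : Om x ->
  (forall t : R, Om (x + t *: v) -> u (x + t *: v) <= u x) ->
  p0 x * px v + p1 x * py v = 0.
Proof.
move=> Ox xmax; have [r r0 rO] := openP oOm Ox.
have [s s0 sP] := line_small v r0.
have Ol (t : R) : t \in `]- s, s[ -> Om (x + t *: v).
  move=> tI; apply: rO; rewrite addrC addKr; apply: sP.
  by move: tI; rewrite in_itv /= ltr_norml.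
have x0 : x + (0 : R) *: v = x by rewrite scale0r addr0.
have I0 : (0 : R) \in `]- s, s[ by rewrite in_itv /=; lra.
have [|t /Ol Ot||t /Ol Ot|_ E] :=
  @derive1_at_max R (fun t => u (x + t *: v)) (- s) s 0.
- by lra.
- by have [] := line_derive hu Ot.
- exact: I0.
- by rewrite x0; exact: xmax.
have [_] := line_derive hu (Ol _ I0); rewrite !x0 => <-.
exact: E.
Qed.

Lemma grad0_max_coord x : Om x -> (forall y, Om y -> u y <= u x) ->
  p0 x = 0 /\ p1 x = 0.
Proof.
move=> Ox xmax; have := @grad0_max _ (mkv 1 0) Ox (fun t => xmax _).
have := @grad0_max _ (mkv 0 1) Ox (fun t => xmax _); rewrite !pE; lra.
Qed.

(* If this function vanishes identically, so does its Laplacian, the Hessian of [u]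
   is a constant singular matrix, and [u] is constant on the line through its
   maximum point directed by the kernel, contradicting [u = 0] on the
   frontier. *)
Lemma ml_gt0 x0 : Om x0 -> (forall y, Om y -> u y <= u x0) ->
  forall x, Om x -> 0 < mlO x.
Proof.
move=> Ox0 xmax.
have [[y [Oy my]]|H] := pselect (exists y, Om y /\ 0 < mlO y).
  by move=> x; exact: ml_gt0_connected my.
exfalso.
have m0 y : Om y -> mlO y = 0.
  move=> Oy; apply/eqP; rewrite eq_le ml_ge0// andbT leNgt; apply/negP => my.
  by apply: H; exists y.
(* With comparison function 0 every point is a minimum of Q, so 0 <= - 8 u |grad u_11|^2. *)
have cd y : Om y -> c y = 0 /\ d y = 0.
  move=> Oy; have [r r0 rO] := openP oOm Oy.
  have D0 v (t : R) : `|t| < r ->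
      is_derive t 1 (fun s => (fun _ => 0) (y + s *: v : 'rV[R]_2)) (0 : R).
    by move=> _; exact: derC.
  have mn z : `|z - y| < r -> mlO y - 0 <= mlO z - 0.
    by move=> /rO Oz; rewrite !m0.
  have := ml_local_min hu hp0 hp1 ha hb hc hd Oy r0 rO mn (D0 (mkv 1 0))
    (derC _ _) (D0 (mkv 0 1)) (derC _ _).
  have := torsion_gt0 Oy; move: (u y) (c y) (d y) => U C D U0 h.
  have : U * (C * C + D * D) <= 0 by lra.
  rewrite pmulr_rle0// => h1.
  by split; nra.
have [px00 px10] := grad0_max_coord Ox0 xmax.
have ux0 := torsion_gt0 Ox0.
pose A := a x0; pose Bb := b x0.
have det0 : (1 + A) * A + Bb * Bb = 0.
  have := m0 _ Ox0; rewrite /mlO /makar_limanov px00 px10 -/A -/Bb => h.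
  have : u x0 * ((1 + A) * A + Bb * Bb) = 0 by lra.
  by move/eqP; rewrite mulf_eq0 gt_eqF//= => /eqP.
have aE y : Om y -> a y = A.
  move=> Oy; apply: (grad_const ha Ox0 Oy) => z Oz.
  by have [-> ->] := cd z Oz; rewrite !mul0r addr0.
have bE y : Om y -> b y = Bb.
  move=> Oy; apply: (grad_const hb Ox0 Oy) => z Oz.
  by have [-> ->] := cd z Oz; rewrite oppr0 !mul0r addr0.
(* ([k0], [k1]) is the now constant Hessian applied to y - x0; its zero set is the kernel line
   through [x0]. *)
pose k0 y := A * (px y - px x0) + Bb * (py y - py x0).
pose k1 y := Bb * (px y - px x0) + (- 1 - A) * (py y - py x0).
have uE y : Om y -> k0 y = 0 -> k1 y = 0 -> u y = u x0.
  move=> Oy ky0 ky1; have line z t : z = x0 + t *: (y - x0) -> 0 <= t <= 1 ->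
      Om z -> p0 z = 0 /\ p1 z = 0.
    move=> zE t01 Oz; split.
      rewrite -[RHS]px00; apply: (grad_const hp0 Ox0 Oz) => w Ow.
      rewrite aE// bE// zE !pE; transitivity (t * k0 y).
        by rewrite /k0; ring.
      by rewrite ky0 mulr0.
    rewrite -[RHS]px10; apply: (grad_const hp1 Ox0 Oz) => w Ow.
    rewrite aE// bE// zE !pE; transitivity (t * k1 y).
      by rewrite /k1; ring.
    by rewrite ky1 mulr0.
  have [t t01|t t01] := @MVT_grad R Om u p0 p1 x0 (y - x0) hu; first exact: cOm.
  have t01' : 0 <= t <= 1 by lra.
  have [-> ->] := line _ t erefl t01' (cOm Ox0 Oy t01').
  by rewrite (addrC x0) subrK !mul0r addr0 => /eqP; rewrite subr_eq0 => /eqP.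
have [w [w0 [kw0 kw1]]] : exists w : 'rV[R]_2,
    0 < px w * px w + py w * py w /\
    (A * px w + Bb * py w = 0 /\ Bb * px w + (- 1 - A) * py w = 0).
  have [AB0|AB] := eqVneq (A * A + Bb * Bb) 0.
    have [A0 B0] : A = 0 /\ Bb = 0 by split; nra.
    exists (mkv 1 0); rewrite !pE A0 B0; lra.
  (* Orthogonal to the first row of the Hessian, hence also to the second one, the determinant being
     0. *)
  exists (mkv Bb (- A)); rewrite !pE; split; last by split; lra.
  by rewrite lt_neqAle; apply/andP; split; [move: AB; rewrite eq_sym; congr (_ != _); ring|nra].
pose C := (closure Om `&` [set z | k0 z = 0]) `&` [set z | k1 z = 0].
have cC : compact C.
  apply: compact_closedI; last by apply: closed_eq0; rewrite /k1; cont.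
  apply: compact_closedI; first exact: compact_closure.
  by apply: closed_eq0; rewrite /k0; cont.
have Cx0 : C x0.
  by split; [split; [exact: Om_closure|]|]; rewrite /= /k0 /k1; ring.
pose L z := px w * px z + py w * py z.
have cL : {within C, continuous L} by rewrite /L; cont.
have [z [[clz /= z0] /= z1] zmax] := compact_max cC (ex_intro _ x0 Cx0) cL.
(* The extreme point of the closure on the kernel line is not on the frontier, since u keeps the
   value [u x0] > 0 along that line up to [z]. A further small move along [w] is then possible and
   contradicts extremality. *)
have Oz : Om z.
  case: (closure_cases clz) => // /u0 uz.
  have [r r0 rP] := within_continuousP cu clz ux0.
  have [s s0 sP] := line_small (x0 - z) r0.
  pose t := Num.min s 1 / 2.
  have mm0 : 0 < Num.min s 1 by rewrite lt_min s0 ltr01.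
  have t0 : 0 < t by rewrite /t; lra.
  have [ts t1] : t < s /\ t < 1 by apply/andP; rewrite -lt_min /t; lra.
  have Ot : Om (z + t *: (x0 - z)) by apply: open_convex_closure => //; lra.
  have tr : `|z + t *: (x0 - z) - z| < r.
    by rewrite addrC addKr; apply: sP; rewrite gtr0_norm.
  have := rP _ (Om_closure Ot) tr.
  rewrite uE// ?uz ?subr0 ?gtr0_norm// ?ltxx//.
    by move: z0; rewrite /k0 !pE; nra.
  by move: z1; rewrite /k1 !pE; nra.
have [r r0 rO] := openP oOm Oz.
have [s s0 sP] := line_small w r0.
have Os : Om (z + (s / 2) *: w).
  by apply: rO; rewrite addrC addKr; apply: sP; rewrite gtr0_norm; lra.
have Cs : C (z + (s / 2) *: w).
  split; [split; [exact: Om_closure|]|] => /=; rewrite /k0 /k1 !pE.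
    transitivity (k0 z + s / 2 * (A * px w + Bb * py w)); first by rewrite /k0; ring.
    by rewrite z0 kw0; ring.
  transitivity (k1 z + s / 2 * (Bb * px w + (- 1 - A) * py w)); first by rewrite /k1; ring.
  by rewrite z1 kw1; ring.
have := zmax _ Cs; rewrite /L !pE.
have : 0 < s / 2 * (px w * px w + py w * py w) by rewrite mulr_gt0//; lra.
lra.
Qed.

End Torsion.

(** * The one-variable inequality for chord maxima *)

Section RealLine2.
Variable R : realType.
Implicit Types (f g : R -> R) (t x y l : R).

Lemma MVT_cc f f' x y : x < y ->
  (forall t, x <= t <= y -> is_derive t 1 f (f' t)) ->
  exists2 c, x < c < y & f y - f x = f' c * (y - x).
Proof.
move=> xy df; have [t|t|c] := @MVT R f f' x y xy.
- by rewrite in_itv /= => /andP[/ltW a /ltW b]; apply: df; rewrite a.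
- apply: derivable_within_continuous => z; rewrite in_itv /= => zI.
  by have [] := df z zI.
by rewrite in_itv /= => cI E; exists c.
Qed.

Lemma deriv_ge0_le f f' x y : x <= y ->
  (forall t, x <= t <= y -> is_derive t 1 f (f' t)) ->
  (forall t, x <= t <= y -> 0 <= f' t) -> f x <= f y.
Proof.
rewrite le_eqVlt => /orP[/eqP -> //|xy] df f0.
have [c /andP[xc cy] E] := MVT_cc xy df.
have : 0 <= f' c * (y - x) by rewrite mulr_ge0 ?f0 ?subr_ge0 ?ltW//; rewrite (ltW xc) ltW.
by rewrite -E subr_ge0.
Qed.

Lemma deriv_lt0_lt f f' x y : x < y ->
  (forall t, x <= t <= y -> is_derive t 1 f (f' t)) ->
  (forall t, x <= t <= y -> f' t < 0) -> f y < f x.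
Proof.
move=> xy df f0; have [c /andP[xc cy] E] := MVT_cc xy df.
have fc : f' c < 0 by apply: f0; rewrite (ltW xc) ltW.
have : f' c * (y - x) < 0 by rewrite nmulr_rlt0// subr_gt0.
by rewrite -E subr_lt0.
Qed.

Lemma is_derive_sqrt f t l : 0 < f t -> is_derive t 1 f l ->
  is_derive t 1 (fun s => Num.sqrt (f s)) (l / (2 * Num.sqrt (f t))).
Proof.
move=> f0 df; have dS := is_derive1_sqrt f0.
have := @is_derive1_comp R Num.sqrt f t _ _ dS df.
by rewrite mulrC.
Qed.

(* The derivative of [q' / sqrt q], i.e. twice the second derivative of
   [sqrt q]. *)
Lemma is_derive_quot_sqrt (q q1 : R -> R) t q2 : 0 < q t ->
  is_derive t 1 q (q1 t) -> is_derive t 1 q1 q2 ->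
  is_derive t 1 (fun s => q1 s * (Num.sqrt (q s))^-1)
    ((2 * q t * q2 - q1 t * q1 t) / (2 * q t * Num.sqrt (q t))).
Proof.
move=> q0 dq dq1; have s0 : 0 < Num.sqrt (q t) by rewrite sqrtr_gt0.
have sn : Num.sqrt (q t) != 0 by rewrite gt_eqF.
have e1 := @derV _ (fun s => Num.sqrt (q s)) t _ sn (is_derive_sqrt q0 dq).
eapply der_eq; [by der|].
have E : q t = Num.sqrt (q t) * Num.sqrt (q t) by rewrite -expr2 sqr_sqrtr// ltW.
by move: (Num.sqrt (q t)) E sn => S E sn; rewrite E /=; field.
Qed.

(* [m] and [- v] are the maximum of [u] on a chord and its derivative; the
   first hypothesis on [w] is a bound [m'' >= - 1] and the second one the
   concavity of [sqrt m].  The monotone quantity is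
   [f - (2 M / 3) l - (2 / 3) m (2 M - 2 m + v ^ 2) / v], found by asking for
   equality on the extremal profiles of [m]. *)
Lemma chord_max_ineq (h0 H M : R) (m v w f : R -> R) :
  0 < h0 -> 0 < H ->
  (forall t, - h0 < t < H -> is_derive t 1 m (- v t)) ->
  (forall t, - h0 < t < H -> is_derive t 1 v (w t)) ->
  (forall t, - h0 < t < H ->
     is_derive t 1 f (2 * m t - v t * v t)) ->
  (forall t, - h0 < t < H -> 0 < m t) ->
  (forall t, - h0 < t < H -> w t <= 1) ->
  (forall t, - h0 < t < H -> 0 < 2 * m t * w t + v t * v t) ->
  m 0 = M -> v 0 = 0 -> f 0 = 0 ->
  forall l, 0 <= l < H -> 2 * M / 3 * l <= f l.
Proof.
move=> h00 H0 dm dv df m0 w1 cv mM v0 f0.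
have I0 t : 0 <= t < H -> - h0 < t < H by lra.
have I00 : - h0 < 0 < H by lra.
have M0 : 0 < M by rewrite -mM; apply: m0.
pose s t := Num.sqrt (m t).
have s0 t : - h0 < t < H -> 0 < s t by move=> tI; rewrite sqrtr_gt0 m0.
have ss t : - h0 < t < H -> s t * s t = m t.
  by move=> tI; rewrite -expr2 sqr_sqrtr// ltW// m0.
(* Twice the derivative of sqrt m, strictly decreasing by the concavity hypothesis. *)
pose r t := - v t * (s t)^-1.
have dr t : - h0 < t < H -> is_derive t 1 r
    ((2 * m t * (- w t) - - v t * - v t) / (2 * m t * s t)).
  move=> tI; exact: (is_derive_quot_sqrt (m0 _ tI) (dm _ tI) (derN (dv _ tI))).
have dr0 t : - h0 < t < H -> (2 * m t * (- w t) - - v t * - v t) / (2 * m t * s t) < 0.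
  move=> tI; have mt := m0 _ tI; have st := s0 _ tI; have := cv _ tI => c.
  by rewrite pmulr_llt0 ?invr_gt0 ?mulr_gt0//; lra.
have rlt x y : 0 <= x -> x < y -> y < H -> r y < r x.
  move=> x0 xy yH; apply: (deriv_lt0_lt xy) => t tI; first by apply: dr; lra.
  by apply: dr0; lra.
have r0 : r 0 = 0 by rewrite /r v0 oppr0 mul0r.
have vpos t : 0 < t -> t < H -> 0 < v t.
  move=> t0 tH; have := rlt 0 t (lexx _) t0 tH; rewrite r0 /r.
  by rewrite pmulr_llt0 ?invr_gt0 ?s0 ?oppr_lt0//; lra.
have vge t : 0 <= t < H -> 0 <= v t.
  rewrite le_eqVlt => /andP[/orP[/eqP <-|t0] tH]; first by rewrite v0.
  exact/ltW/vpos.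
(* Both 2 (M - m) and v^2 vanish at 0, and their derivatives are 2 v and 2 v w, with v >= 0 and w <=
   1. *)
have gge t : 0 <= t < H -> 0 <= 2 * M - 2 * m t - v t * v t.
  move=> /andP[t0 tH].
  pose g z := 2 * M - 2 * m z - v z * v z.
  have : g 0 <= g t.
    apply: (@deriv_ge0_le g (fun t => 2 * v t * (1 - w t)) _ _ t0) => z zI.
  - have zI' : - h0 < z < H by lra.
    have e1 := dm _ zI'; have e2 := dv _ zI'.
    by rewrite /g; eapply der_eq; [by der|rewrite /=; ring].
  - rewrite !mulr_ge0//; first by apply: vge; lra.
    by rewrite subr_ge0 w1//; lra.
  by rewrite /g mM v0; lra.
have sle t : 0 <= t < H -> s t <= s 0.
  move=> /andP[t0 tH]; rewrite ler_wsqrtr// mM.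
  have : 0 <= v t * v t by rewrite -expr2 sqr_ge0.
  have := gge t; lra.
(* By concavity, the mean slope of sqrt m on [0, t] is no steeper than its slope at t. Hence M - m
   is of order v t, which absorbs the factor 1 / v of [Psi] near 0. *)
have Mle t : 0 < t -> t < H -> M - m t <= v t * t * s 0 * (s t)^-1.
  move=> t0 tH; have tI : - h0 < t < H by lra.
  have [z zI|z zI E] := @MVT_cc s (fun z => - v z / (2 * s z)) 0 t t0.
    by apply: is_derive_sqrt; [apply: m0; lra|apply: dm; lra].
  have zI' : - h0 < z < H by lra.
  have rz : v z / s z <= v t / s t.
    by have := rlt z t; rewrite /r !mulNr; lra.
  have E2 : s 0 - s t = v z / s z / 2 * t.
    rewrite -[LHS]opprB E subr0; have : s z != 0 by rewrite gt_eqF// s0.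
    by move=> sz; field.
  have S0 := s0 _ I00; have St := s0 _ tI.
  rewrite -mM -(ss _ I00) -(ss _ tI).
  have -> : v t * t * s 0 * (s t)^-1 = (v t / s t) * t * s 0 by ring.
  move: rz E2 (sle t) S0 St t0; move: (s 0) (s t) (v z / s z) (v t / s t) => S T X Y.
  move=> XY E2 hT S0 St t0; have {}hT : T <= S by apply: hT; lra.
  have h1 : S - T <= Y / 2 * t.
    by rewrite E2; apply: ler_wpM2r; [exact: ltW|lra].
  have h2 : (S - T) * (S + T) <= (Y / 2 * t) * (S + S).
    by apply: ler_pM; lra.
  lra.
pose Psi t := 2 / 3 * (m t * (2 * M - 2 * m t + v t * v t) * (v t)^-1).
have Psi0 t : 0 < t -> t < H -> 0 <= Psi t.
  move=> t0 tH; have tI : - h0 < t < H by lra.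
  have := vpos _ t0 tH => vt; have mt := m0 _ tI.
  have : 0 <= v t * v t by rewrite -expr2 sqr_ge0.
  have gt : 0 <= 2 * M - 2 * m t - v t * v t by apply: gge; lra.
  move=> vv; rewrite /Psi mulr_ge0// ?mulr_ge0 ?invr_ge0 ?(ltW vt) ?(ltW mt)//; lra.
have Psile t : 0 < t -> t < H -> Psi t <= 8 / 3 * M * t.
  move=> t0 tH; have tI : - h0 < t < H by lra.
  have vt := vpos _ t0 tH; have mt := m0 _ tI.
  have gt : 0 <= 2 * M - 2 * m t - v t * v t by apply: gge; lra.
  have MM := Mle _ t0 tH.
  have S0 := s0 _ I00; have St := s0 _ tI.
  have TS : s t <= s 0 by apply: sle; lra.
  have h1 : 2 * M - 2 * m t + v t * v t <= 4 * (v t * t * s 0 * (s t)^-1) by lra.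
  have h2 : m t * (2 * M - 2 * m t + v t * v t) * (v t)^-1
     <= m t * (4 * (v t * t * s 0 * (s t)^-1)) * (v t)^-1.
    rewrite ler_wpM2r ?invr_ge0 ?(ltW vt)//.
    by rewrite ler_wpM2l// (ltW mt).
  have E : m t * (4 * (v t * t * s 0 * (s t)^-1)) * (v t)^-1 = 4 * (s t * s 0) * t.
    rewrite -(ss _ tI); have vn : v t != 0 by rewrite gt_eqF.
    have sn : s t != 0 by rewrite gt_eqF.
    by field; rewrite vn sn.
  rewrite E in h2; rewrite /Psi.
  have h3 : s t * s 0 <= M.
    by rewrite -mM -(ss _ I00) ler_wpM2r// ltW.
  have h4 : s t * s 0 * t <= M * t by rewrite ler_wpM2r// ltW.
  lra.
pose F t := f t - 2 * M / 3 * t - Psi t.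
have dF t : 0 < t -> t < H -> is_derive t 1 F
   (1 / 3 * (2 * M - 2 * m t - v t * v t) *
     ((2 * m t * w t + v t * v t) * ((v t)^-1 * (v t)^-1))).
  move=> t0 tH; have tI : - h0 < t < H by lra.
  have vn : v t != 0 by rewrite gt_eqF// vpos.
  have e1 := dm _ tI; have e2 := dv _ tI; have e3 := df _ tI.
  have e4 := derV vn (dv _ tI).
  rewrite /F /Psi; eapply der_eq; [by der|].
  by rewrite /=; field.
have Fmono x y : 0 < x -> x <= y -> y < H -> F x <= F y.
  move=> x0 xy yH; apply: (deriv_ge0_le xy) => t tI; first by apply: dF; lra.
  rewrite mulr_ge0//; first by rewrite mulr_ge0//; apply: gge; lra.
  rewrite mulr_ge0//; first by apply/ltW/cv; lra.
  by rewrite -expr2 sqr_ge0.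
move=> l /andP[]; rewrite le_eqVlt => /orP[/eqP <- _|l0 lH].
  by rewrite f0 mulr0.
suff Fl : 0 <= F l by have := Psi0 l l0 lH; move: Fl; rewrite /F; lra.
rewrite leNgt; apply/negP => Fl.
have Fl0 : 0 < - F l / 2 by lra.
have cf : {for 0, continuous f}.
  by apply/differentiable_continuous/derivable1_diffP; have [] := df 0 I00.
have /cvgrPdist_lt /(_ _ Fl0) /nbhs_normP[de /= de0 deP] := cf.
(* The sum of 2 / 3 from the linear term of [F] and 8 / 3 from the bound on [Psi], so that F t >= f
   t - K t. *)
pose K := 10 / 3 * M.
have K0 : 0 < K by rewrite /K; lra.
pose t := Num.min (Num.min de l) (- F l / 2 / K) / 2.
have mn0 : 0 < Num.min (Num.min de l) (- F l / 2 / K).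
  by rewrite !lt_min de0 l0 divr_gt0.
have t0 : 0 < t by rewrite /t; lra.
have : t < Num.min (Num.min de l) (- F l / 2 / K) by rewrite /t; lra.
rewrite !lt_min => /andP[/andP[tde tl] tK].
have := Fmono t l t0 (ltW tl) lH.
have tH : t < H by lra.
have := Psile t t0 tH.
have : `|f 0 - f t| < - F l / 2.
  by apply: deP; rewrite /ball_ /= sub0r normrN gtr0_norm.
rewrite f0 sub0r normrN ltr_norml => /andP[hf _] hP.
move: tK; rewrite ltr_pdivlMr// /K => tK.
have FtE : F t = f t - 2 * M / 3 * t - Psi t by [].
lra.
Qed.

End RealLine2.

(** * The curve of chord maxima *)

Section CurveTools.
Variable R : realType.

Lemma is_derive_mkv (gam : R -> 'rV[R]_2) (t w0 w1 : R) :
  is_derive t 1 (fun s => px (gam s)) w0 -> is_derive t 1 (fun s => py (gam s)) w1 ->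
  is_derive t 1 gam (mkv w0 w1).
Proof.
move=> [d0 D0] [d1 D1].
have dg : derivable gam t 1.
  apply/derivable_mxP => i j; rewrite (ord1 i).
  by case: (ord2P j) => ->; [exact: d0|exact: d1].
apply: DeriveDef => //; rewrite derive_mx//; apply: eq_pxy; rewrite pE.
  by rewrite /px mxE.
by rewrite /py mxE.
Qed.

Lemma has_grad_within A C (f g0 g1 : 'rV[R]_2 -> R) : has_grad A f g0 g1 ->
  C `<=` A -> {within C, continuous f}.
Proof.
move=> hf CA; apply: continuous_in_subspaceT => x /set_mem /CA Ax.
exact: has_grad_cont hf Ax.
Qed.

End CurveTools.

(* [P t s] is the point with coordinates [(t, s)] in the orthonormal frame
   centred at [x0] whose first axis is [(n0, n1)]; [un], [ut], [unn], [unt],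
   [utt] are derivatives of [u] in this frame. *)
Section Curve.
Variables (R : realType) (Om : set 'rV[R]_2).
Variables (u p0 p1 a b : 'rV[R]_2 -> R).
Hypothesis oOm : open Om.
Hypothesis cOm : cvx Om.
Hypothesis hu : has_grad Om u p0 p1.
Hypothesis hp0 : has_grad Om p0 a b.
Hypothesis hp1 : has_grad Om p1 b (fun x => - 1 - a x).
Hypothesis ca : {within Om, continuous a}.
Hypothesis cb : {within Om, continuous b}.
Hypothesis u_gt0 : forall x, Om x -> 0 < u x.
Hypothesis mlgt0 : forall x, Om x -> 0 < makar_limanov u p0 p1 a b x.

Variables (n0 n1 : R).
Hypothesis nn : n0 * n0 + n1 * n1 = 1.
Variable x0 : 'rV[R]_2.
Hypothesis Ox0 : Om x0.
Hypothesis px00 : p0 x0 = 0.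
Hypothesis px10 : p1 x0 = 0.

Let P (t s : R) := x0 + mkv (n0 * t - n1 * s) (n1 * t + n0 * s).
Let un x := n0 * p0 x + n1 * p1 x.
Let ut x := - n1 * p0 x + n0 * p1 x.
Let unn x := n0 * n0 * a x + 2 * n0 * n1 * b x + n1 * n1 * (- 1 - a x).
Let unt x := - n0 * n1 * a x + (n0 * n0 - n1 * n1) * b x + n0 * n1 * (- 1 - a x).
Let utt x := n1 * n1 * a x - 2 * n0 * n1 * b x + n0 * n0 * (- 1 - a x).

(* The left-hand side is the determinant, in the rotated frame, of
   [2 u D^2 u - grad u (x) grad u], a positive multiple of the Hessian of
   [sqrt u]. *)
Lemma sqrt_hessian_det x : (2 * u x * unn x - un x * un x) * (2 * u x * utt x - ut x * ut x)
  - (2 * u x * unt x - un x * ut x) * (2 * u x * unt x - un x * ut x)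
  = 2 * u x * makar_limanov u p0 p1 a b x.
Proof.
transitivity ((n0 * n0 + n1 * n1) * (n0 * n0 + n1 * n1) *
   (2 * u x * makar_limanov u p0 p1 a b x)).
  by rewrite /un /ut /unn /unt /utt /makar_limanov; ring.
by rewrite nn !mul1r.
Qed.

Lemma rotated_trace x : unn x + utt x = - 1.
Proof.
transitivity (- (n0 * n0 + n1 * n1)); last by rewrite nn.
by rewrite /unn /utt; ring.
Qed.

(** A symmetric 2 x 2 matrix with positive determinant and negative trace has negative diagonal
    entries. *)
Lemma sqrt_concave x : Om x -> 2 * u x * utt x - ut x * ut x < 0.
Proof.
move=> Ox; have ux := u_gt0 Ox; have mx := mlgt0 Ox.
have D := sqrt_hessian_det x; have T := rotated_trace x.
set X := 2 * u x * unn x - un x * un x in D *.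
set Y := 2 * u x * utt x - ut x * ut x in D *.
have XY : 0 < X * Y.
  have : 0 < 2 * u x * makar_limanov u p0 p1 a b x by rewrite !mulr_gt0.
  rewrite -D; set Z := 2 * u x * unt x - _.
  have : 0 <= Z * Z by rewrite -expr2 sqr_ge0.
  lra.
have S : X + Y < 0.
  have -> : X + Y = 2 * u x * (unn x + utt x) - un x * un x - ut x * ut x.
    by rewrite /X /Y; ring.
  rewrite T.
  have : 0 <= un x * un x by rewrite -expr2 sqr_ge0.
  have : 0 <= ut x * ut x by rewrite -expr2 sqr_ge0.
  lra.
rewrite ltNge; apply/negP => Y0.
have Yn : Y != 0 by apply/eqP => Y00; move: XY; rewrite Y00 mulr0 ltxx.
have {}Y0 : 0 < Y by rewrite lt_neqAle eq_sym Yn.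
by move: XY; rewrite pmulr_lgt0//; lra.
Qed.

Lemma utt_lt0 x : Om x -> ut x = 0 -> utt x < 0.
Proof.
move=> Ox utx; have := sqrt_concave Ox; rewrite utx mulr0 subr0.
by rewrite pmulr_rlt0// mulr_gt0// u_gt0.
Qed.

Lemma P_cvx t1 s1 t2 s2 z : Om (P t1 s1) -> Om (P t2 s2) -> 0 <= z <= 1 ->
  Om (P (t1 + z * (t2 - t1)) (s1 + z * (s2 - s1))).
Proof.
move=> O1 O2 zI; have := cOm O1 O2 zI; congr Om.
by apply: eq_pxy; rewrite /P !pE; ring.
Qed.

Lemma chord_cvx t s1 s2 s : Om (P t s1) -> Om (P t s2) -> s1 <= s <= s2 ->
  Om (P t s).
Proof.
move=> O1 O2 /andP[h1 h2].
have [E|ne] := eqVneq s1 s2.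
  by have -> : s = s1 by apply/eqP; rewrite eq_le h1 E h2.
have lt12 : s1 < s2 by rewrite lt_neqAle ne (le_trans h1).
have sn : s2 - s1 != 0 by rewrite subr_eq0 eq_sym.
have := @P_cvx t s1 t s2 ((s - s1) / (s2 - s1)) O1 O2.
rewrite divfK// subrr mulr0 addr0 (addrC s1) subrK; apply.
by rewrite divr_ge0 ?subr_ge0 ?(ltW lt12)//= ler_pdivrMr ?subr_gt0// mul1r lerD2r.
Qed.

Lemma is_derive_P (alpha beta : R -> R) (t da db : R) :
  is_derive t 1 alpha da -> is_derive t 1 beta db ->
  is_derive t 1 (fun s => P (alpha s) (beta s))
    (mkv (n0 * da - n1 * db) (n1 * da + n0 * db)).
Proof.
move=> e1 e2; apply: is_derive_mkv; rewrite /P; under eq_fun do rewrite !pE.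
  by eapply der_eq; [by der|rewrite /=; ring].
by eapply der_eq; [by der|rewrite /=; ring].
Qed.

Lemma is_derive_u (alpha beta : R -> R) (t da db : R) :
  is_derive t 1 alpha da -> is_derive t 1 beta db -> Om (P (alpha t) (beta t)) ->
  is_derive t 1 (fun s => u (P (alpha s) (beta s)))
    (un (P (alpha t) (beta t)) * da + ut (P (alpha t) (beta t)) * db).
Proof.
move=> e1 e2 O; apply: der_eq (chain_rule hu (is_derive_P e1 e2) O) _.
by rewrite /un /ut !pE; ring.
Qed.

Lemma is_derive_ut (alpha beta : R -> R) (t da db : R) :
  is_derive t 1 alpha da -> is_derive t 1 beta db -> Om (P (alpha t) (beta t)) ->
  is_derive t 1 (fun s => ut (P (alpha s) (beta s)))
    (unt (P (alpha t) (beta t)) * da + utt (P (alpha t) (beta t)) * db).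
Proof.
move=> e1 e2 O; have g := is_derive_P e1 e2.
have f1 := chain_rule hp0 g O; have f2 := chain_rule hp1 g O.
rewrite /ut; eapply der_eq; [by der|].
by rewrite /unt /utt !pE /=; ring.
Qed.

Lemma is_derive_un (alpha beta : R -> R) (t da db : R) :
  is_derive t 1 alpha da -> is_derive t 1 beta db -> Om (P (alpha t) (beta t)) ->
  is_derive t 1 (fun s => un (P (alpha s) (beta s)))
    (unn (P (alpha t) (beta t)) * da + unt (P (alpha t) (beta t)) * db).
Proof.
move=> e1 e2 O; have g := is_derive_P e1 e2.
have f1 := chain_rule hp0 g O; have f2 := chain_rule hp1 g O.
rewrite /un; eapply der_eq; [by der|].
by rewrite /unn /unt !pE /=; ring.
Qed.

(** The quotient is twice the derivative of sqrt u along the chord, and sqrt u is strictly concave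
    there. *)
Lemma chord_decr t s1 s2 : Om (P t s1) -> Om (P t s2) -> s1 < s2 ->
  ut (P t s2) * (Num.sqrt (u (P t s2)))^-1
    < ut (P t s1) * (Num.sqrt (u (P t s1)))^-1.
Proof.
move=> O1 O2 lt12.
pose r s := ut (P t s) * (Num.sqrt (u (P t s)))^-1.
pose r' s := (2 * u (P t s) * utt (P t s) - ut (P t s) * ut (P t s)) /
   (2 * u (P t s) * Num.sqrt (u (P t s))).
apply: (@deriv_lt0_lt R r r' s1 s2 lt12) => s sI.
  have O := chord_cvx O1 O2 sI.
  apply: (is_derive_quot_sqrt (u_gt0 O)).
    apply: der_eq (is_derive_u (derC s t) (derI s) O) _.
    by rewrite mulr0 add0r mulr1.
  apply: der_eq (is_derive_ut (derC s t) (derI s) O) _.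
  by rewrite mulr0 add0r mulr1.
have O := chord_cvx O1 O2 sI; have uO := u_gt0 O.
by rewrite /r' pmulr_llt0 ?sqrt_concave// invr_gt0 mulr_gt0 ?mulr_gt0 ?sqrtr_gt0.
Qed.

Lemma ut_sign t s1 s2 : Om (P t s1) -> Om (P t s2) -> s1 < s2 ->
  (ut (P t s1) = 0 -> ut (P t s2) < 0) /\ (ut (P t s2) = 0 -> 0 < ut (P t s1)).
Proof.
move=> O1 O2 lt12; have D := chord_decr O1 O2 lt12.
split=> E; move: D; rewrite E mul0r.
  by rewrite pmulr_llt0// invr_gt0 sqrtr_gt0 u_gt0.
by rewrite pmulr_lgt0// invr_gt0 sqrtr_gt0 u_gt0.
Qed.

Lemma ut_uniq t s1 s2 : Om (P t s1) -> Om (P t s2) ->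
  ut (P t s1) = 0 -> ut (P t s2) = 0 -> s1 = s2.
Proof.
move=> O1 O2 E1 E2; apply/eqP; case: (ltgtP s1 s2) => // h.
  by have := (ut_sign O1 O2 h).1 E1; rewrite E2 ltxx.
by have := (ut_sign O2 O1 h).1 E2; rewrite E1 ltxx.
Qed.

Lemma P_dist t s t' s' : `|P t' s' - P t s| <= 2 * (`|t' - t| + `|s' - s|).
Proof.
have nn' := nn; have k0 : `|n0| <= 1 by rewrite ler_norml; nra.
have k1 : `|n1| <= 1 by rewrite ler_norml; nra.
have bd (k X : R) : `|k| <= 1 -> `|k * X| <= `|X|.
  by move=> kk; rewrite normrM ler_piMl.
have a1 := bd _ (t' - t) k0; have a2 := bd _ (s' - s) k1.
have a3 := bd _ (t' - t) k1; have a4 := bd _ (s' - s) k0.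
have b1 := normr_ge0 (t' - t); have b2 := normr_ge0 (s' - s).
rewrite norm_pxy ge_max /P !pE; apply/andP; split.
  have -> : px x0 + (n0 * t' - n1 * s') - (px x0 + (n0 * t - n1 * s)) =
     n0 * (t' - t) - n1 * (s' - s) by ring.
  by apply: le_trans (ler_normB _ _) _; lra.
have -> : py x0 + (n1 * t' + n0 * s') - (py x0 + (n1 * t + n0 * s)) =
   n1 * (t' - t) + n0 * (s' - s) by ring.
by apply: le_trans (ler_normD _ _) _; lra.
Qed.

Variables (h0 H : R).
Hypothesis h00 : 0 < h0.
Hypothesis H0 : 0 < H.
(** An arbitrary selection of critical points on the chords; its regularity is deduced from their
    uniqueness. *)
Variable sig : R -> R.
Hypothesis sigO : forall t, - h0 < t < H -> Om (P t (sig t)).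
Hypothesis sig0 : forall t, - h0 < t < H -> ut (P t (sig t)) = 0.

Lemma ut_within : {within Om, continuous ut}.
Proof.
have e0 := has_grad_within hp0 (@subset_refl _ Om).
have e1 := has_grad_within hp1 (@subset_refl _ Om).
by rewrite /ut; cont.
Qed.

(** On the chord at [t] the tangential derivative is positive before [sig t] and negative after it.
    These signs persist on nearby chords, and the zero they enclose must be the selected one. *)
Lemma sig_continuous t : - h0 < t < H -> forall e : R, 0 < e ->
  exists2 de : R, 0 < de & forall h : R, `|h| < de -> `|sig (t + h) - sig t| < e.
Proof.
move=> tI e e0; have Os := sigO tI; have us := sig0 tI.
have [r r0 rO] := openP oOm Os.
pose m := Num.min (r / 2) e / 2.
have mm0 : 0 < Num.min (r / 2) e by rewrite lt_min e0; lra.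
have m0 : 0 < m by rewrite /m; lra.
have [mr me] : m < r / 2 /\ m < e by apply/andP; rewrite -lt_min /m; lra.
have Om1 : Om (P t (sig t - m)).
  apply: rO; apply: le_lt_trans (P_dist _ _ _ _) _; rewrite subrr normr0.
  by rewrite (_ : sig t - m - sig t = - m) ?normrN ?gtr0_norm//; [lra|ring].
have Om2 : Om (P t (sig t + m)).
  apply: rO; apply: le_lt_trans (P_dist _ _ _ _) _; rewrite subrr normr0.
  by rewrite (_ : sig t + m - sig t = m) ?gtr0_norm//; [lra|ring].
have lt1 : sig t - m < sig t by lra.
have lt2 : sig t < sig t + m by lra.
have u1 := (ut_sign Om1 Os lt1).2 us.
have u2 := (ut_sign Os Om2 lt2).1 us.
have u2' : 0 < - ut (P t (sig t + m)) by lra.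
have [r1 r10 r1P] := within_continuousP ut_within Om1 u1.
have [r2 r20 r2P] := within_continuousP ut_within Om2 u2'.
have [r3 r30 r3P] := openP oOm Om1.
have [r4 r40 r4P] := openP oOm Om2.
pose d1 := Num.min (Num.min r1 r2) (Num.min r3 r4).
pose de := Num.min (d1 / 2) (Num.min (H - t) (t + h0)).
have d10 : 0 < d1 by rewrite !lt_min r10 r20 r30.
have de0 : 0 < de by rewrite !lt_min; lra.
exists de => // h; rewrite !lt_min => /and3P[hd hH hh].
have hI : - h0 < t + h < H by move: hH hh; rewrite !ltr_norml; lra.
have Pd s : `|P (t + h) s - P t s| < d1.
  apply: le_lt_trans (P_dist _ _ _ _) _; rewrite subrr normr0 addr0.
  by rewrite (addrC t) addrK; lra.
have := Pd (sig t - m); rewrite !lt_min => /andP[/andP[b1 _] /andP[b3 _]].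
have := Pd (sig t + m); rewrite !lt_min => /andP[/andP[_ b2] /andP[_ b4]].
have O1 := r3P _ b3; have O2 := r4P _ b4.
have v1 : 0 < ut (P (t + h) (sig t - m)).
  by have := r1P _ O1 b1; rewrite ltr_norml; lra.
have v2 : ut (P (t + h) (sig t + m)) < 0.
  by have := r2P _ O2 b2; rewrite ltr_norml; lra.
have lt12 : sig t - m <= sig t + m by lra.
have [||s sI sE] := @IVT R (fun s => ut (P (t + h) s)) (sig t - m) (sig t + m) 0 lt12.
- apply: derivable_within_continuous => s; rewrite in_itv /= => sI.
  have O := chord_cvx O1 O2 sI.
  by have [] := is_derive_ut (derC s (t + h)) (derI s) O.
- by rewrite ge_min le_max; apply/andP; split; apply/orP; [right|left]; exact: ltW.
move: sI; rewrite in_itv /= => sI.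
have -> : sig (t + h) = s.
  by apply: (@ut_uniq (t + h)) => //; [exact: sigO|exact: (chord_cvx O1 O2)|exact: sig0].
by rewrite ltr_norml; lra.
Qed.

(** The tangential derivative vanishes at both ends of the segment joining two points of the curve.
    The mean value theorem on it gives 0 = u_nutau h + u_tautau k at an intermediate point, and k /
    h converges by continuity. *)
Lemma sig_derive t : - h0 < t < H ->
  is_derive t 1 sig (- unt (P t (sig t)) / utt (P t (sig t))).
Proof.
move=> tI; have Os := sigO tI; have us := sig0 tI.
have tt := utt_lt0 Os us.
have ctt : {within Om, continuous utt} by rewrite /utt; cont.
have cnt : {within Om, continuous unt} by rewrite /unt; cont.
have tt' : 0 < - utt (P t (sig t)) by lra.
have [r1 r10 r1P] := within_continuousP ctt Os tt'.
have [r2 r20 r2P] := openP oOm Os.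
pose C := [set x | Om x /\ utt x < 0].
have CO : C `<=` Om by move=> x [].
have Cs : C (P t (sig t)) by [].
have cq : {within C, continuous (fun x => - unt x * (utt x)^-1)}.
  have e1 := within_continuous_sub CO ctt.
  have e2 := within_continuous_sub CO cnt.
  have e3 : {within C, continuous (fun x => (utt x)^-1)}.
    by apply: withinV => // x [_ h]; rewrite lt_eqF.
  by cont.
apply: eps_der => e e0.
have [r3 r30 r3P] := within_continuousP cq Cs e0.
pose r := Num.min (Num.min r1 r2) r3.
have r0 : 0 < r by rewrite !lt_min r10 r20.
have r4 : 0 < r / 4 by lra.
have [d1 d10 d1P] := sig_continuous tI r4.
pose de := Num.min (Num.min d1 (r / 4)) (Num.min (H - t) (t + h0)).
have de0 : 0 < de by rewrite !lt_min; lra.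
exists de => // h hn; rewrite !lt_min => /andP[/andP[hd hr] /andP[hH hh]].
have hI : - h0 < t + h < H by move: hH hh; rewrite !ltr_norml; lra.
pose k := sig (t + h) - sig t.
have kr : `|k| < r / 4 by exact: d1P.
have sE : sig (t + h) = sig t + k by rewrite /k; ring.
have Pclose z : 0 <= z <= 1 -> `|P (t + z * h) (sig t + z * k) - P t (sig t)| < r.
  move=> zI; apply: le_lt_trans (P_dist _ _ _ _) _.
  rewrite (addrC t) addrK (addrC (sig t)) addrK.
  have zz (X : R) : `|z * X| <= `|X|.
    by rewrite normrM ler_piMl// ger0_norm; lra.
  by have := zz h; have := zz k; lra.
have CP z : 0 <= z <= 1 -> [/\ Om (P (t + z * h) (sig t + z * k)),
    C (P (t + z * h) (sig t + z * k)) &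
    `|P (t + z * h) (sig t + z * k) - P t (sig t)| < r3].
  move=> /Pclose; rewrite !lt_min => /andP[/andP[b1 b2] b3].
  have O := r2P _ b2; split => //; split => //.
  by have := r1P _ O b1; rewrite ltr_norml; lra.
have [z zI|z zI] := @MVT01 R (fun z => ut (P (t + z * h) (sig t + z * k)))
  (fun z => unt (P (t + z * h) (sig t + z * k)) * h
          + utt (P (t + z * h) (sig t + z * k)) * k).
  have [Oz _ _] := CP z zI.
  have e1 : is_derive z 1 (fun z => t + z * h) h.
    by eapply der_eq; [by der|rewrite /=; ring].
  have e2 : is_derive z 1 (fun z => sig t + z * k) k.
    by eapply der_eq; [by der|rewrite /=; ring].
  exact: (is_derive_ut e1 e2 Oz).
rewrite !mul1r !mul0r !addr0 -sE (sig0 hI) us subrr => E.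
have zI' : 0 <= z <= 1 by lra.
have [Oz [_ Cz] rz] := CP z zI'.
have := r3P _ (conj Oz Cz) rz.
suff -> : k / h = - unt (P (t + z * h) (sig t + z * k)) *
    (utt (P (t + z * h) (sig t + z * k)))^-1 by [].
have tn : utt (P (t + z * h) (sig t + z * k)) != 0 by rewrite lt_eqF.
apply: (mulIf hn); rewrite divfK//; apply: (mulIf tn).
rewrite mulrAC divfK// -[RHS]addr0 E; ring.
Qed.

(** [fX] stands for X . nu in the domain; the gradient below is - D^2 phi applied to nu, expressed
    through u. *)
Variable fX : 'rV[R]_2 -> R.
Hypothesis hfX : has_grad Om fX
  (fun x => (p0 x * p0 x + p1 x * p1 x + 2 * u x) * n0 - 2 * un x * p0 x)
  (fun x => (p0 x * p0 x + p1 x * p1 x + 2 * u x) * n1 - 2 * un x * p1 x).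

Lemma curve_ineq l : 0 <= l < H ->
  2 * u x0 / 3 * l <= fX (P l (sig l)) - fX x0.
Proof.
move=> lI; have P00 : P 0 0 = x0.
  by apply: eq_pxy; rewrite /P !pE; ring.
have I0 : - h0 < 0 < H by have := h00; have := H0; lra.
(* The maximum point [x0] is critical on its own chord, and a chord has a single critical point. *)
have sig00 : sig 0 = 0.
  apply: (@ut_uniq 0); [exact: sigO|by rewrite P00|exact: sig0|].
  by rewrite P00 /ut px00 px10; ring.
have gx0 : P 0 (sig 0) = x0 by rewrite sig00.
pose g t := P t (sig t).
(* This is - m'': the slope of the curve turns the second derivative of m into a Schur complement of
   the Hessian. *)
pose w t := - (unn (g t) - unt (g t) * unt (g t) / utt (g t)).
apply: (@chord_max_ineq R h0 H (u x0) (fun t => u (g t)) (fun t => - un (g t)) w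
   (fun t => fX (g t) - fX x0) h00 H0 _ _ _ _ _ _ _ _ _ l lI).
- move=> t tI; have O := sigO tI.
  apply: der_eq (is_derive_u (derI t) (sig_derive tI) O) _.
  by rewrite sig0// mul0r addr0 mulr1 opprK.
- move=> t tI; have O := sigO tI; have tn := utt_lt0 O (sig0 tI).
  apply: der_eq (derN (is_derive_un (derI t) (sig_derive tI) O)) _.
  have {}tn : utt (P t (sig t)) != 0 by rewrite lt_eqF.
  by rewrite /w /g; field.
- move=> t tI; have O := sigO tI; have ut0 := sig0 tI.
  have G := is_derive_P (derI t) (sig_derive tI).
  have e1 := chain_rule hfX G O.
  eapply der_eq; [by der|].
  rewrite /g !pE; move: ut0; set x := P t (sig t); set k := - unt x / utt x.
  move=> ut0; set S := p0 x * p0 x + p1 x * p1 x + 2 * u x.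
  have SE : S = un x * un x + 2 * u x.
    have : (n0 * n0 + n1 * n1) * (p0 x * p0 x + p1 x * p1 x)
      = un x * un x + ut x * ut x by rewrite /un /ut; ring.
    by rewrite nn mul1r ut0 mulr0 addr0 /S => ->.
  transitivity ((n0 * n0 + n1 * n1) * S - 2 * un x * un x - 2 * un x * k * ut x).
    by rewrite /un /ut; ring.
  by rewrite nn ut0 SE; ring.
- by move=> t tI; apply: u_gt0; exact: sigO.
- move=> t tI; have O := sigO tI; have tn := utt_lt0 O (sig0 tI).
  have := rotated_trace (g t); rewrite /w => T.
  (* The trace identity eliminates u_nunu; what is added to 1 is nonpositive because u_tautau <
     0. *)
  have -> : - (unn (g t) - unt (g t) * unt (g t) / utt (g t)) =
     1 + utt (g t) + unt (g t) * unt (g t) / utt (g t) by lra.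
  have : unt (g t) * unt (g t) / utt (g t) <= 0.
    rewrite mulr_ge0_le0 ?invr_le0 ?(ltW tn)//.
    by rewrite -expr2 sqr_ge0.
  by move: tn; rewrite -/(g t); lra.
- move=> t tI; have O := sigO tI; have tn := utt_lt0 O (sig0 tI).
  have ug := u_gt0 O; have mg := mlgt0 O; have ut0 := sig0 tI.
  have := sqrt_hessian_det (P t (sig t)); rewrite /w /g ut0 !mulr0 !subr0.
  move: (unn _) (unt _) (utt _) (un _) (u _) (makar_limanov _ _ _ _ _ _) tn ug mg.
  move=> NN NT TT N U Q tn ug mg E.
  have tn' : TT != 0 by rewrite lt_eqF.
  (* On the curve u_tau = 0, and the determinant identity reduces the concavity expression to - Q /
     u_tautau. *)
  have -> : 2 * U * - (NN - NT * NT / TT) + - N * - N = - Q / TT.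
    have Un : 2 * U != 0 by rewrite gt_eqF// mulr_gt0.
    apply: (mulfI Un); rewrite mulrA.
    transitivity (- (2 * U * Q) / TT); last by field.
    by rewrite -E; field.
  by rewrite mulNr oppr_gt0 pmulr_rlt0// invr_lt0.
- by rewrite /g gx0.
- by rewrite /g gx0 /un px00 px10; ring.
- by rewrite /g gx0 subrr.
Qed.

End Curve.

(** * Derivatives of the torsion function, Hessian of the Airy potential, separation *)

Section Assembly.
Variable R : realType.
Implicit Types (A : set 'rV[R]_2).

Lemma smooth_has_grad A f s : open A -> smooth_on A f ->
  has_grad A (pderiv s f) (pderiv (0 :: s) f) (pderiv (1 :: s) f).
Proof.
move=> oA sf; apply: (C1_has_grad oA) => y i Ay.
  by have [_ /(_ i)] := sf s y Ay.
by have [] := sf (i :: s) y Ay.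
Qed.

Lemma pderiv_congr A (f g : 'rV[R]_2 -> R) i x : open A -> A x ->
  (forall y, A y -> f y = g y) -> pderiv [:: i] f x = pderiv [:: i] g x.
Proof.
move=> oA Ax fg; apply: near_eq_derive.
have := open_nbhs_nbhs (conj oA Ax); apply: filterS => y; exact: fg.
Qed.

Lemma has_gradW A (f g0 g1 h0 h1 : 'rV[R]_2 -> R) : has_grad A f g0 g1 ->
  (forall x, A x -> g0 x = h0 x) -> (forall x, A x -> g1 x = h1 x) ->
  has_grad A f h0 h1.
Proof.
by move=> hf e0 e1 x Ax; have [df dE] := hf x Ax; rewrite -e0// -e1.
Qed.

Lemma has_grad_comb A (f f0 f1 g g0 g1 : 'rV[R]_2 -> R) (al be : R) :
  has_grad A f f0 f1 -> has_grad A g g0 g1 ->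
  has_grad A (fun x => al * f x + be * g x)
    (fun x => al * f0 x + be * g0 x) (fun x => al * f1 x + be * g1 x).
Proof.
move=> hf hg x Ax; have [df fE] := hf x Ax; have [dg gE] := hg x Ax.
have E : (fun x => al * f x + be * g x) = (al *: f) + (be *: g) by [].
have d1 := differentiableZ al df; have d2 := differentiableZ be dg.
rewrite E; split; first exact: differentiableD.
move=> v; rewrite (diffD d1 d2) /= (diffZ al df) (diffZ be dg) -[LHS]/(al * 'd f x v + be * 'd g x v).
by rewrite fE gE; ring.
Qed.

(** Symmetry of mixed derivatives and differentiation of Lap u = - 1 give u_22 = - 1 - u_11, u_122 =
    - u_111 and u_1122 = - u_1111, so the derivatives used up to order four involve at most one
    differentiation in the second variable. *)
Lemma torsion_jets A u : open A -> smooth_on A u ->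
  (forall x, A x -> - laplacian u x = 1) ->
  [/\ has_grad A u (pderiv [:: 0] u) (pderiv [:: 1] u),
      has_grad A (pderiv [:: 0] u) (pderiv [:: 0; 0] u) (pderiv [:: 0; 1] u) &
      has_grad A (pderiv [:: 1] u) (pderiv [:: 0; 1] u)
        (fun x => - 1 - pderiv [:: 0; 0] u x)] /\
  [/\ has_grad A (pderiv [:: 0; 0] u) (pderiv [:: 0; 0; 0] u)
        (pderiv [:: 1; 0; 0] u),
      has_grad A (pderiv [:: 0; 1] u) (pderiv [:: 1; 0; 0] u)
        (fun x => - pderiv [:: 0; 0; 0] u x),
      has_grad A (pderiv [:: 0; 0; 0] u) (pderiv [:: 0; 0; 0; 0] u)
        (pderiv [:: 1; 0; 0; 0] u) &
      has_grad A (pderiv [:: 1; 0; 0] u) (pderiv [:: 1; 0; 0; 0] u)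
        (fun x => - pderiv [:: 0; 0; 0; 0] u x)].
Proof.
move=> oA su lap.
have hg s := smooth_has_grad s oA su.
have sw s x : A x -> pderiv (1 :: 0 :: s) u x = pderiv (0 :: 1 :: s) u x.
  apply: (schwarz oA (hg s) (hg (0 :: s)) (hg (1 :: s))) => y Ay.
    by have [] := su (1 :: 0 :: s) y Ay.
  by have [] := su (0 :: 1 :: s) y Ay.
have cg s s' i : (forall x, A x -> pderiv s u x = pderiv s' u x) ->
    forall x, A x -> pderiv (i :: s) u x = pderiv (i :: s') u x.
  by move=> h x Ax; exact: (@pderiv_congr A (pderiv s u) (pderiv s' u) i x oA Ax h).
have dN s i x : A x -> 'D_(delta_mx ord0 i) (fun y => - pderiv s u y) x
    = - pderiv (i :: s) u x.
  move=> Ax; have [_ /(_ i) d] := su s x Ax.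
  exact: (deriveN d).
have l2 x : A x -> pderiv [:: 1; 1] u x = - 1 - pderiv [:: 0; 0] u x.
  have E : laplacian u x = pderiv [:: 0; 0] u x + pderiv [:: 1; 1] u x.
    by rewrite /laplacian big_ord_recl big_ord1 (_ : lift ord0 ord0 = 1)//; exact: val_inj.
  move=> /lap; rewrite {}E; move: (pderiv [:: 1; 1] u x) (pderiv [:: 0; 0] u x) => X Y.
  lra.
have l3 i x : A x -> pderiv [:: i; 1; 1] u x = - pderiv [:: i; 0; 0] u x.
  move=> Ax; have [_ /(_ i) d] := su [:: 0; 0] x Ax.
  have -> : pderiv [:: i; 1; 1] u x = pderiv [:: i] (fun y => - 1 - pderiv [:: 0; 0] u y) x.
    exact: (@pderiv_congr A (pderiv [:: 1; 1] u)
       (fun y => - 1 - pderiv [:: 0; 0] u y) i x oA Ax l2).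
  have dc : derivable (fun _ : 'rV[R]_2 => - 1 : R) x (delta_mx ord0 i).
    exact: derivable_cst.
  have -> : pderiv [:: i] (fun y => - 1 - pderiv [:: 0; 0] u y) x =
     'D_(delta_mx ord0 i) (fun _ : 'rV[R]_2 => - 1 : R) x - pderiv [:: i; 0; 0] u x.
    exact: (deriveB dc d).
  by rewrite derive_cst sub0r.
have l101 x : A x -> pderiv [:: 1; 0; 1] u x = - pderiv [:: 0; 0; 0] u x.
  by move=> Ax; rewrite (sw [:: 1] x Ax) l3.
have l001 x : A x -> pderiv [:: 0; 0; 1] u x = pderiv [:: 1; 0; 0] u x.
  move=> Ax; transitivity (pderiv [:: 0; 1; 0] u x).
    exact: (cg [:: 0; 1] [:: 1; 0] 0 (fun y Ay => esym (sw [::] y Ay)) x Ax).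
  exact: (esym (sw [:: 0] x Ax)).
split; split.
- exact: hg [::].
- by apply: has_gradW (hg [:: 0]) (fun _ _ => erefl) (sw [::]).
- by apply: has_gradW (hg [:: 1]) (fun _ _ => erefl) l2.
- exact: hg [:: 0; 0].
- by apply: has_gradW (hg [:: 0; 1]) l001 l101.
- exact: hg [:: 0; 0; 0].
- apply: has_gradW (hg [:: 1; 0; 0]) (fun x Ax => esym (sw [:: 0; 0] x Ax)) _ => x Ax.
  transitivity (pderiv [:: 1; 0; 0; 1] u x).
    exact: (cg [:: 1; 0; 0] [:: 0; 0; 1] 1 (fun y Ay => esym (l001 y Ay)) x Ax).
  transitivity (pderiv [:: 0; 1; 0; 1] u x); first exact: (sw [:: 0; 1] x Ax).
  rewrite -[RHS](dN [:: 0; 0; 0] 0 x Ax).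
  exact: (@pderiv_congr A (pderiv [:: 1; 0; 1] u)
       (fun y => - pderiv [:: 0; 0; 0] u y) 0 x oA Ax l101).
Qed.

(** Conjugation by the rotation exchanges the diagonal entries and changes the sign of the others,
    so the Hessian is read off [Sigma] entry by entry. *)
Lemma airy_hessian (A : set 'rV[R]_2) u phi x : airy_potential A u phi -> A x ->
  let p0 := pderiv [:: 0] u x in let p1 := pderiv [:: 1] u x in
  [/\ pderiv [:: 0; 0] phi x = p0 * p0 - p1 * p1 - 2 * u x,
      pderiv [:: 0; 1] phi x = 2 * p0 * p1,
      pderiv [:: 1; 0] phi x = 2 * p0 * p1 &
      pderiv [:: 1; 1] phi x = p1 * p1 - p0 * p0 - 2 * u x].
Proof.
move=> [_ /(_ x)] H Ax p0 p1; have {}H := H Ax.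
have l1 : lift ord0 ord0 = (1 : 'I_2) by exact: val_inj.
have E i j := congr1 (fun M : 'M[R]_2 => M i j) H.
have g0 : px (grad u x) = p0 by rewrite /px /grad mxE.
have g1 : py (grad u x) = p1 by rewrite /py /grad mxE.
have S i j : Sigma u x i j = (p0 * p0 + p1 * p1 - 2 * u x) *+ (i == j)
   - 2 * (grad u x ord0 i * grad u x ord0 j).
  by rewrite /Sigma dotE g0 g1 !mxE big_ord1 !mxE.
have [h [hE J]] : exists h : 'I_2 -> 'I_2 -> R,
    (forall i j, h i j = pderiv [:: i; j] phi x) /\
    (forall i j, ((rotJ R)^T *m hessian phi x *m rotJ R) i j =
       \sum_k (\sum_l rotJ R l i * h l k) * rotJ R k j).
  exists (fun i j => pderiv [:: i; j] phi x); split => // i j.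
  rewrite mxE; apply: eq_bigr => k _; rewrite mxE; congr (_ * _).
  by apply: eq_bigr => l _; rewrite !mxE.
rewrite -!hE; clearbody p0 p1; clear hE.
have sum2 (F : 'I_2 -> R) : \sum_i F i = F 0 + F 1.
  by rewrite big_ord_recl big_ord1 l1.
have [J00 J01 J10 J11] : [/\ rotJ R 0 0 = 0, rotJ R 0 1 = - 1, rotJ R 1 0 = 1
    & rotJ R 1 1 = 0] by rewrite /rotJ !mxE.
have eS i j : (p0 * p0 + p1 * p1 - 2 * u x) *+ (i == j)
   - 2 * (grad u x ord0 i * grad u x ord0 j) =
   (rotJ R 0 i * h 0 0 + rotJ R 1 i * h 1 0) * rotJ R 0 j
   + (rotJ R 0 i * h 0 1 + rotJ R 1 i * h 1 1) * rotJ R 1 j.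
  by rewrite -S E J !sum2.
have e00 := eS 0 0; have e01 := eS 0 1; have e10 := eS 1 0; have e11 := eS 1 1.
move: e00 e01 e10 e11; rewrite !J00 !J01 !J10 !J11.
rewrite -![grad u x _ 0]/(px _) -![grad u x _ 1]/(py _) !g0 !g1 /=.
rewrite ?mulr1n ?mulr0n; move: (u x) (h 0 0) (h 0 1) (h 1 0) (h 1 1) => U a b c d.
by move=> *; split; lra.
Qed.

(** The normal points from the point [y0] of [K] nearest to [z] towards [z]; a point of [K] strictly
    beyond the orthogonal line at [y0] would allow a move of [y0] closer to [z]. *)
Lemma separation (K : set 'rV[R]_2) z : compact K -> cvx K -> K !=set0 -> ~ K z ->
  exists n0 n1 : R, n0 * n0 + n1 * n1 = 1 /\
    forall y, K y -> n0 * px y + n1 * py y < n0 * px z + n1 * py z.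
Proof.
move=> cK vK K0 Kz.
have [y0 Ky0 ymin] := compact_min cK K0 (@sqdist_cont R K z).
pose X := px z - px y0; pose Y := py z - py y0.
have NE : sqdist z y0 = X * X + Y * Y by rewrite /sqdist /X /Y; ring.
have N0 : 0 < X * X + Y * Y.
  rewrite lt_neqAle eq_sym; apply/andP; split; last by nra.
  apply/eqP => XY; apply: Kz; suff -> : z = y0 by [].
  by apply: eq_pxy; apply/eqP; rewrite -subr_eq0; apply/eqP; rewrite -/X -/Y; nra.
pose N := Num.sqrt (X * X + Y * Y).
have Np : 0 < N by rewrite sqrtr_gt0.
have NN : N * N = X * X + Y * Y by rewrite -expr2 sqr_sqrtr// ltW.
have key y : K y -> X * (px y - px y0) + Y * (py y - py y0) <= 0.
  move=> Ky; rewrite leNgt; apply/negP.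
  set w0 := px y - px y0; set w1 := py y - py y0 => pos.
  pose D := X * w0 + Y * w1; pose W := w0 * w0 + w1 * w1.
  have W0 : 0 <= W by rewrite /W; nra.
  (* This choice gives both t <= 1 and t W <= D, so the squared distance changes by at most - t D <
     0. *)
  pose t := D / (W + D).
  have WD : 0 < W + D by rewrite /D; lra.
  have t0 : 0 < t by rewrite /t divr_gt0.
  have t1 : t <= 1 by rewrite /t ler_pdivrMr// mul1r; lra.
  have tE : t * (W + D) = D by rewrite /t divfK// gt_eqF.
  have t01 : 0 <= t <= 1 by lra.
  have := ymin _ (vK _ _ _ Ky0 Ky t01).
  have -> : sqdist z (y0 + t *: (y - y0)) = sqdist z y0 - 2 * t * D + t * t * W.
    by rewrite NE /sqdist /D /W /w0 /w1 /X /Y !pE; ring.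
  have tD : 0 < t * D by rewrite mulr_gt0.
  have tt : t * t * W <= t * D.
    by rewrite -mulrA ler_wpM2l ?(ltW t0)//; nra.
  lra.
exists (X / N), (Y / N); have Nn : N != 0 by rewrite gt_eqF.
split.
  transitivity ((X * X + Y * Y) / (N * N)); first by field.
  by rewrite NN divff// gt_eqF.
move=> y /key h.
rewrite -subr_gt0.
have -> : X / N * px z + Y / N * py z - (X / N * px y + Y / N * py y)
   = (X * X + Y * Y - (X * (px y - px y0) + Y * (py y - py y0))) / N.
  by rewrite /X /Y; field.
by rewrite divr_gt0//; lra.
Qed.

Lemma closed_ge_within (C : set 'rV[R]_2) (g : 'rV[R]_2 -> R) : closed C ->
  {within C, continuous g} -> closed (C `&` [set x | 0 <= g x]).
Proof.
move=> cC cg x clx.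
have Cx : C x by apply: cC; apply: closureS clx => y [].
split => //=; rewrite leNgt; apply/negP => gx.
have gx' : 0 < - g x by lra.
have [r r0 rP] := within_continuousP cg Cx gx'.
have [y [Cy /= gy] yx] := (closureP _ x).1 clx r r0.
by have := rP y Cy yx; rewrite ltr_norml; lra.
Qed.

End Assembly.

(** * A frontier point realizing the support inequality *)

Section Support.
Variables (R : realType) (Om : set 'rV[R]_2).
Variables (u p0 p1 a b : 'rV[R]_2 -> R).
Hypothesis oOm : open Om.
Hypothesis cOm : cvx Om.
Variable B : R.
Hypothesis bOm : forall x, Om x -> `|x| <= B.
Hypothesis hu : has_grad Om u p0 p1.
Hypothesis hp0 : has_grad Om p0 a b.
Hypothesis hp1 : has_grad Om p1 b (fun x => - 1 - a x).
Hypothesis ca : {within Om, continuous a}.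
Hypothesis cb : {within Om, continuous b}.
Hypothesis cu : {within closure Om, continuous u}.
Hypothesis u0 : forall x, frontier Om x -> u x = 0.
Hypothesis mlgt0 : forall x, Om x -> 0 < makar_limanov u p0 p1 a b x.
Variable x0 : 'rV[R]_2.
Hypothesis Ox0 : Om x0.
Hypothesis xmax : forall y, Om y -> u y <= u x0.
Variables (n0 n1 : R).
Hypothesis nn : n0 * n0 + n1 * n1 = 1.
Variables (fX fE : 'rV[R]_2 -> R).
Hypothesis hfX : has_grad Om fX
  (fun x => (p0 x * p0 x + p1 x * p1 x + 2 * u x) * n0
     - 2 * (n0 * p0 x + n1 * p1 x) * p0 x)
  (fun x => (p0 x * p0 x + p1 x * p1 x + 2 * u x) * n1
     - 2 * (n0 * p0 x + n1 * p1 x) * p1 x).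
Hypothesis cfE : {within closure Om, continuous fE}.
Hypothesis fEX : forall x, Om x -> fE x = fX x.

Let L x := n0 * (px x - px x0) + n1 * (py x - py x0).

Lemma height_cont C : {within C, continuous L}.
Proof. by rewrite /L; cont. Qed.

Lemma height_affine x y t : L (x + t *: (y - x)) = L x + t * (L y - L x).
Proof. by rewrite /L !pE; ring. Qed.

Lemma height_x0 : L x0 = 0.
Proof. by rewrite /L; ring. Qed.

Lemma u_gt0 x : Om x -> 0 < u x.
Proof. exact: (torsion_gt0 oOm bOm hu hp0 hp1 cu u0). Qed.

(** The maximum of u over the closed chord is positive, hence is not attained on the frontier. *)
Lemma chord_argmax y : Om y -> exists z, [/\ Om z, L z = L y &
  - n1 * p0 z + n0 * p1 z = 0].
Proof.
move=> Oy.
pose C := closure Om `&` [set z | L z - L y = 0].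
have cC : compact C.
  apply: compact_closedI; first exact: compact_closure bOm.
  by apply: closed_eq0; have h := @height_cont setT; cont.
have Cy : C y by split; [exact: subset_closure|rewrite /= subrr].
have cuC : {within C, continuous u}.
  by apply: within_continuous_sub cu => z [].
have [z [clz /= Lz] zmax] := compact_max cC (ex_intro _ y Cy) cuC.
have uz : 0 < u z by apply: lt_le_trans (u_gt0 Oy) (zmax _ Cy).
have Oz : Om z.
  by case: (closure_cases oOm clz) => // /u0 uz0; rewrite uz0 ltxx in uz.
exists z; split => //; first by apply/eqP; rewrite -subr_eq0; apply/eqP.
have := @grad0_max R Om u p0 p1 oOm hu z (mkv (- n1) n0) Oz.
rewrite !pE => <-; first by ring.
move=> t Ot; apply: zmax; split; first exact: subset_closure.
by rewrite /= -Lz /L !pE; ring.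
Qed.

Lemma support_ineq : exists2 p, frontier Om p &
  forall x, Om x -> 2 * u x0 / 3 * L x <= fE p - fE x0.
Proof.
have clx0 : closure Om x0 by exact: subset_closure.
have ux0 := u_gt0 Ox0.
have [q clq qmax] := compact_max (compact_closure bOm) (ex_intro _ x0 clx0)
  (@height_cont (closure Om)).
have nn' := nn.
have up x (r : R) : L (x + r *: mkv n0 n1) = L x + r.
  transitivity (L x + r * (n0 * n0 + n1 * n1)); first by rewrite /L !pE; ring.
  by rewrite nn mulr1.
have Llt x : Om x -> L x < L q.
  move=> Ox; have [r r0 rO] := openP oOm Ox.
  have [s s0 sP] := line_small (mkv n0 n1) r0.
  have s2 : 0 < s / 2 by lra.
  have Os : Om (x + (s / 2) *: mkv n0 n1).
    by apply: rO; rewrite addrC addKr; apply: sP; rewrite gtr0_norm//; lra.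
  by have := qmax _ (subset_closure Os); rewrite up; lra.
pose H := L q.
have H0 : 0 < H by have := Llt _ Ox0; rewrite height_x0.
(* A margin [h0] on the negative side makes 0 an interior parameter, where two-sided derivatives
   exist. *)
have [r r0 rO] := openP oOm Ox0.
have [h0 h00 h0P] := line_small (mkv n0 n1) r0.
have ex t : - h0 < t < H -> exists2 y, Om y & L y = t.
  move=> /andP[th tH]; have [t0|t0] := ltP t 0.
    exists (x0 + t *: mkv n0 n1); last by rewrite up height_x0 add0r.
    by apply: rO; rewrite addrC addKr; apply: h0P; rewrite ltr0_norm//; lra.
  exists (q + (1 - t / H) *: (x0 - q)).
    apply: open_convex_closure => //; rewrite subr_gt0 ltr_pdivrMr// mul1r tH /=.
    by rewrite lerBlDr lerDl divr_ge0// ltW.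
  rewrite height_affine height_x0 -/H; have Hn : H != 0 by rewrite gt_eqF.
  by field.
have [sig sigP] : {sig : R -> R & forall t, - h0 < t < H ->
    Om (x0 + mkv (n0 * t - n1 * sig t) (n1 * t + n0 * sig t)) /\
    - n1 * p0 (x0 + mkv (n0 * t - n1 * sig t) (n1 * t + n0 * sig t))
    + n0 * p1 (x0 + mkv (n0 * t - n1 * sig t) (n1 * t + n0 * sig t)) = 0}.
  apply: (@choice R R (fun t s => - h0 < t < H ->
    Om (x0 + mkv (n0 * t - n1 * s) (n1 * t + n0 * s)) /\
    - n1 * p0 (x0 + mkv (n0 * t - n1 * s) (n1 * t + n0 * s))
    + n0 * p1 (x0 + mkv (n0 * t - n1 * s) (n1 * t + n0 * s)) = 0)) => t.
  (* Outside the range of heights the selection takes the irrelevant value 0. *)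
  have [tI|tI] := boolP (- h0 < t < H); last by exists 0.
  have [y Oy Ly] := ex t tI; have [z [Oz Lz zt]] := chord_argmax Oy.
  exists (- n1 * (px z - px x0) + n0 * (py z - py x0)) => _.
  have -> : x0 + mkv (n0 * t - n1 * (- n1 * (px z - px x0) + n0 * (py z - py x0)))
     (n1 * t + n0 * (- n1 * (px z - px x0) + n0 * (py z - py x0))) = z.
    apply: eq_pxy; rewrite !pE -Ly -Lz /L.
      transitivity (px x0 + (n0 * n0 + n1 * n1) * (px z - px x0)); first by ring.
      by rewrite nn; ring.
    transitivity (py x0 + (n0 * n0 + n1 * n1) * (py z - py x0)); first by ring.
    by rewrite nn; ring.
  by [].
have [px00 px10] := grad0_max_coord oOm hu Ox0 xmax.
have curve := curve_ineq oOm cOm hu hp0 hp1 ca cb u_gt0 mlgt0 nn Ox0 px00 px10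
  h00 H0 (fun t tI => (sigP t tI).1) (fun t tI => (sigP t tI).2) hfX.
pose Phi x := fE x - fE x0 - 2 * u x0 / 3 * L x.
have cPhi : {within closure Om, continuous Phi}.
  by have h := @height_cont (closure Om); rewrite /Phi; cont.
(* The compact set where the desired inequality holds. It contains curve points of every height in
   [0, H), so its highest point has height at least [H] and lies on the frontier. *)
pose G := closure Om `&` [set x | 0 <= Phi x].
have clG : closed G by apply: closed_ge_within => //; exact: closed_closure.
have cG : compact G.
  have -> : G = closure Om `&` G by apply/seteqP; split => [z [? ?]//|z []].
  by apply: compact_closedI => //; exact: compact_closure bOm.
have Gx0 : G x0 by split => //=; rewrite /Phi height_x0 subrr mulr0 subr0.
have [p [clp /= Phip] pmax] := compact_max cG (ex_intro _ x0 Gx0) (@height_cont G).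
have Lp : H <= L p.
  rewrite leNgt; apply/negP => LpH.
  have Lp0 : 0 <= L p by rewrite -height_x0; exact: pmax.
  pose l := (L p + H) / 2.
  have lI : 0 <= l < H by rewrite /l; lra.
  have lI' : - h0 < l < H by lra.
  have [Ol _] := sigP l lI'; have := curve l lI.
  set y := x0 + mkv _ _ in Ol *; rewrite -!fEX// => cy.
  have Ly : L y = l.
    rewrite /L /y !pE; transitivity ((n0 * n0 + n1 * n1) * l); first by ring.
    by rewrite nn mul1r.
  have Gy : G y.
    by split; [exact: subset_closure|rewrite /= /Phi Ly; lra].
  by have := pmax _ Gy; rewrite Ly /l; lra.
have fp : frontier Om p.
  apply: (frontierI oOm) => // /Llt; rewrite -/H; lra.
exists p => // x /Llt Lx; move: Phip; rewrite /Phi.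
have k0 : 0 <= 2 * u x0 / 3 by lra.
have : 2 * u x0 / 3 * L x <= 2 * u x0 / 3 * L p.
  by apply: ler_wpM2l => //; apply: le_trans Lp; exact: ltW.
lra.
Qed.

End Support.

(** * Conclusion by separation from K *)

Lemma within_coord (R : realType) (C : set 'rV[R]_2) (X : 'rV[R]_2 -> 'rV[R]_2) :
  {within C, continuous X} ->
  {within C, continuous (fun x => px (X x))} /\
  {within C, continuous (fun x => py (X x))}.
Proof.
move=> cX; split => x.
  exact: (continuous_comp (cX x) (@px_continuous R _)).
exact: (continuous_comp (cX x) (@py_continuous R _)).
Qed.

Theorem proposition4p3 (R : realType) (Omega : set 'rV[R]_2)
    (u phi : 'rV[R]_2 -> R) (X : 'rV[R]_2 -> 'rV[R]_2)
    (M : R) (x0 : 'rV[R]_2) (K : set 'rV[R]_2)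
    (Omega_domain : domain Omega)
    (Omega_bounded : bounded_set Omega)
    (Omega_smooth : smooth_boundary Omega)
    (Omega_strictly_convex : strictly_convex Omega)
    (u_torsion : torsion_function Omega u)
    (M_max : (u @` Omega) M /\ ubound (u @` Omega) M)
    (x0_max : Omega x0 /\ u x0 = M)
    (phi_airy : airy_potential Omega u phi)
    (X_def : is_opp_grad Omega phi X)
    (K_body : convex_body K)
    (K_frontier : frontier K = X @` frontier Omega) :
  [set (2 * M / 3) *: (x - x0) | x in Omega] `<=` [set y - X x0 | y in K].
Proof.
have [oOm _ conOm] := Omega_domain.
have [/convex_set_cvx cOm scOm] := Omega_strictly_convex.
have [B _ bOm] := bounded_setP Omega_bounded.
have [[su cu ext] lap u0] := u_torsion.
have [Ox0 ux0] := x0_max.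
have xmax y : Omega y -> u y <= u x0.
  by move=> Oy; rewrite ux0; apply: M_max.2; exists y.
have [cK /convex_set_cvx vK intK] := K_body.
have [cX XE] := X_def.
have [[hu hp0 hp1] [ha hb hc hd]] := torsion_jets oOm su lap.
have [E0 [cE0 EE0]] := ext [:: 0]; have [E1 [cE1 EE1]] := ext [:: 1].
have [Ea [cEa EEa]] := ext [:: 0; 0]; have [Eb [cEb EEb]] := ext [:: 0; 1].
have mlgt0 := ml_gt0 oOm cOm scOm conOm bOm hu hp0 hp1 ha hb hc hd cu u0
  cE0 cE1 cEa cEb EE0 EE1 EEa EEb Ox0 xmax.
have ca := has_grad_within ha (@subset_refl _ Omega).
have cb := has_grad_within hb (@subset_refl _ Omega).
move=> _ [x Ox <-]; pose z := X x0 + (2 * M / 3) *: (x - x0).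
exists z; last by rewrite /z addrC addKr.
apply: contrapT => Kz.
have clK : closed K by apply: compact_closed => //; exact: norm_hausdorff.
have K0 : K !=set0 by case: intK => y /interior_subset Ky; exists y.
(* The direction is chosen only now: the support inequality is used for the one normal that
   separates [z] from [K]. *)
have [n0 [n1 [nn sep]]] := separation cK vK K0 Kz.
have sphi := phi_airy.1.
case: sphi => sphi _ _.
have hphi0 := smooth_has_grad [:: 0] oOm sphi.
have hphi1 := smooth_has_grad [:: 1] oOm sphi.
pose fX y := - n0 * pderiv [:: 0] phi y + - n1 * pderiv [:: 1] phi y.
(* The same quantity X . nu as [fX], written through [X] so that it is continuous up to the
   frontier. *)
pose fE y := n0 * px (X y) + n1 * py (X y).
have hfX : has_grad Omega fX
  (fun x => (pderiv [:: 0] u x * pderiv [:: 0] u x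
     + pderiv [:: 1] u x * pderiv [:: 1] u x + 2 * u x) * n0
     - 2 * (n0 * pderiv [:: 0] u x + n1 * pderiv [:: 1] u x) * pderiv [:: 0] u x)
  (fun x => (pderiv [:: 0] u x * pderiv [:: 0] u x
     + pderiv [:: 1] u x * pderiv [:: 1] u x + 2 * u x) * n1
     - 2 * (n0 * pderiv [:: 0] u x + n1 * pderiv [:: 1] u x) * pderiv [:: 1] u x).
  apply: has_gradW (has_grad_comb (- n0) (- n1) hphi0 hphi1) _ _ => y Oy.
    have [-> -> _ _] := airy_hessian phi_airy Oy.
    by move: (pderiv [:: 0] u y) (pderiv [:: 1] u y) => *; ring.
  have [_ _ -> ->] := airy_hessian phi_airy Oy.
  by move: (pderiv [:: 0] u y) (pderiv [:: 1] u y) => *; ring.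
have cfE : {within closure Omega, continuous fE}.
  by have [h0 h1] := within_coord cX; rewrite /fE; cont.
have fEX y : Omega y -> fE y = fX y.
  move=> Oy; rewrite /fE XE// !pE.
  have -> : px (grad phi y) = pderiv [:: 0] phi y by rewrite /px mxE.
  have -> : py (grad phi y) = pderiv [:: 1] phi y by rewrite /py mxE.
  by rewrite /fX !mulNr !mulrN.
have [p fp pP] := support_ineq oOm cOm bOm hu hp0 hp1 ca cb cu u0 mlgt0 Ox0 xmax
  nn hfX cfE fEX.
have KXp : K (X p).
  have : frontier K (X p) by rewrite K_frontier; exists p.
  by case=> /clK.
have := pP _ Ox; have := sep _ KXp; rewrite ux0 /fE /z !pE.
move: (px (X p)) (py (X p)) (px (X x0)) (py (X x0)) => *; lra.
Qed.
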